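(* Let $Q \simeq \mathbb{Z}^s$ be a finitely generated free abelian group, $s \geq 2$, and let $A = \mathbb{Z}Q/I$ be a domain of characteristic zero. Suppose that $A$ has Krull dimension $2$ and that the image in $A$ of any non-trivial element of $Q$ is not algebraic over $\mathbb{Q}$. Then $A$ is $Q$-homothety rigid.
   Context: For a subgroup $H\le Q$, $\mathbb{Z}H$ denotes its integral group ring, viewed as a subring of $\mathbb{Z}Q$. Definition: let $Q$ be a finitely generated free abelian group of rank $s$ and $A = \mathbb{Z}Q/I$ a domain of characteristic zero. $A$ is $Q$-homothety rigid if the following holds: whenever $Q = \langle x_1, \ldots, x_s\rangle$ and there are positive integers $n, c_1, \ldots, c_s$ and a ring homomorphism $$\mathbb{Z}\langle x_1^{n}, \ldots, x_s^{n} \rangle / (\mathbb{Z}\langle x_1^{n}, \ldots, x_s^{n} \rangle \cap I) \to \mathbb{Z}\langle x_1^{c_1}, \ldots, x_s^{c_s} \rangle / (\mathbb{Z}\langle x_1^{c_1}, \ldots, x_s^{c_s} \rangle \cap I)$$ that sends (the class of) $x_i^{n}$ to (the class of) $x_i^{c_i}$ for $1 \leq i \leq s$, then $n = c_1 = \cdots = c_s$. The Krull dimension of a commutative ring is the maximal length $k$ of a chain of prime ideals $P_0 \subsetneq \dots \subsetneq P_k$. Algebraicity over $\mathbb{Q}$ is understood in the field of fractions of $A$. *)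

(* Defs.v *)
From HB Require Import structures.
From mathcomp Require Import all_boot all_order all_algebra.
From mathcomp Require Import finmap boolp.
From mathcomp.multinomials Require Import monalg.

Set Implicit Arguments.
Unset Strict Implicit.
Unset Printing Implicit Defensive.

Import GRing.Theory.

Local Open Scope fset_scope.
Local Open Scope ring_scope.
Local Open Scope quotient_scope.

(* The group Q is written additively: the product x y, the power x^n and the  *)
(* identity of the multiplicative notation are x + y, x *+ n and 0.           *)

Definition free_abelian_of_rank (Q : zmodType) (s : nat) : Prop :=
  exists f : {additive Q -> 'rV[int]_s}, bijective f.

Section Generated.
Variables (Q : zmodType) (s : nat) (y : 'I_s -> Q).

Definition gensub : {pred Q} :=
  fun q => `[< exists m : 'I_s -> int, q = \sum_(i < s) y i *~ m i >].

Lemma gensub_zmod_closed : zmod_closed gensub.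
Proof.
split; first by apply/asboolP; exists (fun=> 0); rewrite big1.
move=> _ _ /asboolP[m ->] /asboolP[m' ->]; apply/asboolP.
exists (fun i => m i - m' i); rewrite -sumrB; apply: eq_bigr => i _.
by rewrite mulrzBr.
Qed.

HB.instance Definition _ := GRing.isZmodClosed.Build Q gensub gensub_zmod_closed.

Lemma gensub_gen i : y i \in gensub.
Proof.
apply/asboolP; exists (fun j => (j == i)%:R); rewrite (bigD1 i) //= eqxx.
by rewrite big1 ?addr0 // => j /negbTE ->.
Qed.

Definition generates : Prop := forall q : Q, q \in gensub.

End Generated.

(* The ring structure on {malg R[K]} in the library requires the monoid K to  *)
(* have no nontrivial invertible element, so it does not apply to groups.     *)

Definition grpring (Q : zmodType) : Type := {malg int[Q]}.

Section GroupRing.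
Variable Q : zmodType.

HB.instance Definition _ := GRing.Zmodule.on (grpring Q).

Implicit Types g : grpring Q.

Definition gr_of (q : Q) : grpring Q := << 1 *g q >>.

Local Notation term g1 g2 k1 k2 := << g1@_k1 * g2@_k2 *g (k1 + k2 : Q) >>.

Definition gr_mul g1 g2 : grpring Q :=
  \sum_(k1 <- msupp g1) \sum_(k2 <- msupp g2) term g1 g2 k1 k2.

Lemma gr_mulw (d1 d2 : {fset Q}) g1 g2 :
  msupp g1 `<=` d1 -> msupp g2 `<=` d2 ->
  gr_mul g1 g2 = \sum_(k1 <- d1) \sum_(k2 <- d2) term g1 g2 k1 k2.
Proof.
move=> le_d1 le_d2; rewrite /gr_mul (big_fset_incl _ le_d1) /=.
  apply/eq_bigr=> k1 _; apply/big_fset_incl => // k _ /mcoeff_outdom ->.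
  by rewrite mulr0 monalgU0.
move=> k _ /mcoeff_outdom g1k.
by rewrite big1 => // k' _; rewrite g1k mul0r monalgU0.
Qed.

Lemma gr_mulC : commutative gr_mul.
Proof.
move=> g1 g2; rewrite /gr_mul exchange_big; apply: eq_bigr => k _.
by apply: eq_bigr => k' _; rewrite mulrC addrC.
Qed.

Lemma gr_mul0g : left_zero 0 gr_mul.
Proof. by move=> g; rewrite /gr_mul msupp0 big_seq_fset0. Qed.

Lemma gr_mulUg c k g :
  gr_mul << c *g k >> g = \sum_(k' <- msupp g) << c * g@_k' *g k + k' >>.
Proof.
rewrite (gr_mulw msuppU_le (fsubset_refl _)) big_seq_fset1.
by apply/eq_bigr => k' _; rewrite mcoeffUU.
Qed.

Lemma gr_mulUU c1 c2 k1 k2 :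
  gr_mul << c1 *g k1 >> << c2 *g k2 >> = << c1 * c2 *g k1 + k2 >>.
Proof. by rewrite (gr_mulw msuppU_le msuppU_le) !big_seq_fset1 !mcoeffUU. Qed.

Lemma gr_mul1g : left_id (gr_of 0) gr_mul.
Proof.
move=> g; rewrite gr_mulUg [RHS]monalgE.
by apply/eq_bigr=> k _; rewrite mul1r add0r.
Qed.

Lemma gr_mulDl : left_distributive gr_mul +%R.
Proof.
move=> g1 g2 g.
rewrite [in RHS](gr_mulw (fsubsetUl _ (msupp g2)) (fsubset_refl _)).
rewrite [in RHS](gr_mulw (fsubsetUr (msupp g1) _) (fsubset_refl _)).
rewrite (gr_mulw (msuppD_le _ _) (fsubset_refl _)).
rewrite -big_split /=; apply/eq_bigr=> k1 _.
rewrite -big_split /=; apply/eq_bigr=> k2 _.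
by rewrite mcoeffD mulrDl monalgUD.
Qed.

Lemma gr_mulDr : right_distributive gr_mul +%R.
Proof. by move=> g g1 g2; rewrite !(gr_mulC g) gr_mulDl. Qed.

Lemma gr_mulg0 : right_zero 0 gr_mul.
Proof. by move=> g; rewrite gr_mulC gr_mul0g. Qed.

Lemma gr_mulEl g1 g2 :
  gr_mul g1 g2 = \sum_(k1 <- msupp g1) gr_mul << g1@_k1 *g k1 >> g2.
Proof. by apply/eq_bigr=> k _; rewrite gr_mulUg. Qed.

Lemma gr_mulEr g1 g2 :
  gr_mul g1 g2 = \sum_(k2 <- msupp g2) gr_mul g1 << g2@_k2 *g k2 >>.
Proof. by rewrite gr_mulC gr_mulEl; apply: eq_bigr => k _; rewrite gr_mulC. Qed.

Lemma gr_mulA : associative gr_mul.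
Proof.
move=> g1 g2 g3.
rewrite [RHS](big_morph (gr_mul^~ _) (fun _ _ => gr_mulDl _ _ _) (gr_mul0g _)).
rewrite gr_mulEl; apply/eq_bigr=> k1 _.
rewrite [LHS](big_morph (gr_mul _) (fun _ _ => gr_mulDr _ _ _) (gr_mulg0 _)).
rewrite [RHS](big_morph (gr_mul^~ _) (fun _ _ => gr_mulDl _ _ _) (gr_mul0g _)).
apply/eq_bigr=> k2 _.
rewrite !(gr_mulEr _ g3).
rewrite [LHS](big_morph (gr_mul _) (fun _ _ => gr_mulDr _ _ _) (gr_mulg0 _)).
by apply/eq_bigr=> k3 _; rewrite !gr_mulUU mulrA addrA.
Qed.

Lemma gr_one_neq0 : gr_of 0 != 0.
Proof. by rewrite monalgU_eq0. Qed.

HB.instance Definition _ := GRing.Zmodule_isComNzRing.Build (grpring Q)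
  gr_mulA gr_mulC gr_mul1g gr_mulDl gr_one_neq0.

Variable H : zmodClosed Q.

Definition supported_in : {pred grpring Q} :=
  fun g => all (fun q => q \in H) (msupp g).

Lemma supported_inP g :
  reflect (forall q, q \in msupp g -> q \in H) (g \in supported_in).
Proof. exact: allP. Qed.

Lemma supported_in_subring_closed : subring_closed supported_in.
Proof.
split.
- by apply/supported_inP => q /(fsubsetP msuppU_le); rewrite inE => /eqP ->;
    exact: rpred0.
- move=> g1 g2 /supported_inP h1 /supported_inP h2.
  apply/supported_inP => q /(fsubsetP (msuppB_le _ _)).
  by rewrite inE => /orP[/h1|/h2].
move=> g1 g2 /supported_inP h1 /supported_inP h2.
apply/supported_inP => q; apply: contraTT => qH; rewrite -mcoeff_eq0.
rewrite [g1 * g2]/(gr_mul g1 g2) raddf_sum big_seq big1 // => k1 k1g.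
rewrite raddf_sum big_seq big1 // => k2 k2g /=; rewrite mcoeffU.
case: eqP => [e|]; last by rewrite mulr0n.
by case/negP: qH; rewrite -e; apply: rpredD; [exact: h1 k1g|exact: h2 k2g].
Qed.

HB.instance Definition _ :=
  GRing.isSubringClosed.Build (grpring Q) supported_in
    supported_in_subring_closed.

(* ZH as a subring of ZQ. *)
Definition subgrpring : Type := {g : grpring Q | g \in supported_in}.

HB.instance Definition _ := SubChoice.on subgrpring.
HB.instance Definition _ := [SubChoice_isSubComNzRing of subgrpring by <:].

Lemma gr_of_supported q : q \in H -> gr_of q \in supported_in.
Proof.
by move=> qH; apply/supported_inP => k /(fsubsetP msuppU_le); rewrite inE => /eqP ->.
Qed.

Definition subgr_of q (qH : q \in H) : subgrpring :=
  exist _ (gr_of q) (gr_of_supported qH).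

Variable I : idealr (grpring Q).

Definition restr_ideal : {pred subgrpring} := fun u => val u \in (I : pred _).

Lemma restr_ideal_closed : idealr_closed restr_ideal.
Proof.
split; first by rewrite unfold_in rmorph0 rpred0.
  by rewrite unfold_in rmorph1 idealr1.
move=> a u v; rewrite !unfold_in => uI vI.
rewrite rmorphD rmorphM; apply: (@rpredD _ I); [exact: idealMr|exact: vI].
Qed.

HB.instance Definition _ :=
  isIdealr.Build subgrpring restr_ideal restr_ideal_closed.

Definition subquot : Type := {ideal_quot restr_ideal}.

HB.instance Definition _ := GRing.ComNzRing.on subquot.

End GroupRing.

Arguments restr_ideal {Q} H I.
Arguments subquot {Q} H I.

(* The library equips a quotient by an ideal with a ring structure only; the  *)
(* unit structure is needed to form the fraction field.                       *)
Section QuotientDomain.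
Variables (R : comNzRingType).

Section Unit.
Variable I : idealr R.
Local Notation A := {ideal_quot I}.

Definition quot_unit : {pred A} := fun a => `[< exists b, b * a = 1 >].

Definition quot_inv (a : A) : A :=
  if pselect (exists b, b * a = 1) is left e then projT1 (cid e) else a.

Lemma quot_mulVr : {in quot_unit, left_inverse 1 quot_inv *%R}.
Proof.
move=> a /asboolP h; rewrite /quot_inv; case: pselect => // e.
exact: projT2 (cid e).
Qed.

Lemma quot_unitPl (a b : A) : b * a = 1 -> quot_unit a.
Proof. by move=> h; apply/asboolP; exists b. Qed.

Lemma quot_invr_out : {in [predC quot_unit], quot_inv =1 id}.
Proof.
move=> a; rewrite !inE => /asboolP h; rewrite /quot_inv.
by case: pselect.
Qed.

HB.instance Definition _ := GRing.ComNzRing_hasMulInverse.Build A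
  quot_mulVr quot_unitPl quot_invr_out.
End Unit.

HB.instance Definition _ (I : prime_idealr R) :=
  GRing.ComUnitRing_isIntegral.Build {ideal_quot I} (@Quotient.rquot_IdomainAxiom R I).
End QuotientDomain.

Section Krull.
Variable R : comNzRingType.

Definition prime_chain (k : nat) (P : 'I_k.+1 -> prime_idealr R) : Prop :=
  forall i j : 'I_k.+1, (i < j)%N ->
    {subset (P i : pred R) <= (P j : pred R)} /\
    ~ {subset (P j : pred R) <= (P i : pred R)}.

Definition krull_dim_eq (d : nat) : Prop :=
  (exists P : 'I_d.+1 -> prime_idealr R, prime_chain P) /\
  (forall k (P : 'I_k.+1 -> prime_idealr R), prime_chain P -> (k <= d)%N).
End Krull.

Definition algebraic_over_rat (D : idomainType) (a : D) : Prop :=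
  algebraicOver (ratr : rat -> {fraction D}) (FracField.tofrac a).

Section Rigid.
Variables (Q : zmodType) (I : prime_idealr (grpring Q)).

Definition gr_quot : Type := {ideal_quot I}.

HB.instance Definition _ := GRing.IntegralDomain.on gr_quot.

(* The image of q in A = ZQ/I. *)
Definition gr_image (q : Q) : gr_quot := \pi_({ideal_quot I}) (gr_of q).

Definition gen_quot (s : nat) (y : 'I_s -> Q) : Type := subquot (gensub y) I.

HB.instance Definition _ s (y : 'I_s -> Q) := GRing.ComNzRing.on (gen_quot y).

(* The class of y i in ZH/(ZH ∩ I), where H is generated by y. *)
Definition gen_class (s : nat) (y : 'I_s -> Q) (i : 'I_s) : gen_quot y :=
  \pi_({ideal_quot (restr_ideal (gensub y) I)}) (subgr_of (gensub_gen y i)).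

Definition homothety_rigid (s : nat) : Prop :=
  forall (x : 'I_s -> Q) (n : nat) (c : 'I_s -> nat),
    generates x -> (0 < n)%N -> (forall i, 0 < c i)%N ->
    forall f : {rmorphism gen_quot (fun i => x i *+ n) ->
                          gen_quot (fun i => x i *+ c i)},
    (forall i, f (gen_class (fun i => x i *+ n) i) =
               gen_class (fun i => x i *+ c i) i) ->
    forall i, c i = n.

End Rigid.

(* Main.v *)
From HB Require Import structures.
From mathcomp Require Import all_boot all_order all_algebra.
From mathcomp Require Import finmap boolp classical_sets ring zify polyXY.
From mathcomp.multinomials Require Import monalg.
Require Import Defs.

Set Implicit Arguments.
Unset Strict Implicit.
Unset Printing Implicit Defensive.

Import GRing.Theory Num.Theory.
Local Open Scope ring_scope.

(** A has transcendence degree 1: if a, b in A were algebraically independent,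
    Zariski's lemma would yield primes P1 < P2 < P3 of A with P1 avoiding the
    nonzero elements of Z[b] and P2 avoiding the nonzero integers, a chain of
    length 3. So any two elements of A are algebraically dependent.

    Let x, y be the images of two basis elements, c1, c2 the two exponents. The
    ring homomorphism, iterated, gives P(x^N, y^N) = 0 iff P(x^C1, y^C2) = 0 for
    N = n^m, C1 = c1^m, C2 = c2^m. Let D be the derivation of Q(x, y) with
    D x = x, and r = (D y)/y. Differentiating the minimal relation of
    (x^N, y^N) expresses r rationally in x^N, y^N, whence
    P(x^N, r) = 0 iff P(x^C1, (C2/C1) r) = 0.

    If r is algebraic over Q, comparing the coefficients of the minimal
    relation P and of D P shows that r = e/d is rational and then that
    y^d x^-e is algebraic, which is excluded. Otherwise r is
    transcendental, and the degree in r of a minimal relation between x^N and r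
    lies between two constant multiples of N; hence n^m / c1^m stays bounded
    above and below, and c1 = n. *)

(** * Finitely generated domains *)

Section Adjoin.
Variables (R A : comNzRingType) (iota : {rmorphism R -> A}) (l : A).

Definition adjoin : {pred A} :=
  fun a => `[< exists p : {poly R}, a = (map_poly iota p).[l] >].

Lemma adjoinP a :
  reflect (exists p : {poly R}, a = (map_poly iota p).[l]) (a \in adjoin).
Proof. exact: asboolP. Qed.

Lemma adjoin_subring_closed : subring_closed adjoin.
Proof.
split; first by apply/adjoinP; exists 1; rewrite rmorph1 hornerC.
  move=> _ _ /adjoinP[p ->] /adjoinP[q ->]; apply/adjoinP; exists (p - q).
  by rewrite rmorphB hornerD hornerN.
move=> _ _ /adjoinP[p ->] /adjoinP[q ->]; apply/adjoinP; exists (p * q).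
by rewrite rmorphM hornerM.
Qed.

HB.instance Definition _ :=
  GRing.isSubringClosed.Build A adjoin adjoin_subring_closed.

Definition adjoin_ring : Type := {a : A | a \in adjoin}.

HB.instance Definition _ := SubChoice.on adjoin_ring.
HB.instance Definition _ := [SubChoice_isSubComNzRing of adjoin_ring by <:].

Definition adjoin_val : adjoin_ring -> A := val.
HB.instance Definition _ := GRing.RMorphism.on adjoin_val.

Lemma adjoin_valP (h : adjoin_ring) :
  exists p : {poly R}, adjoin_val h = (map_poly iota p).[l].
Proof. exact/adjoinP/(valP h). Qed.

Lemma adjoin_horner (p : {poly R}) :
  exists h : adjoin_ring, adjoin_val h = (map_poly iota p).[l].
Proof.
have hp : (map_poly iota p).[l] \in adjoin by apply/adjoinP; exists p.
by exists (exist (fun a => a \in adjoin) _ hp).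
Qed.

End Adjoin.

(** Generation as an algebra, stated through subrings, so that [generated_adjoin] can move the
    generators one at a time into the base ring. *)
Definition generated_over (R A : comNzRingType) (iota : R -> A) (ls : seq A) :=
  forall S : {pred A}, subring_closed S -> (forall r, iota r \in S) ->
    {in ls, forall l, l \in S} -> forall a, a \in S.

Lemma generated_adjoin (R A : comNzRingType) (iota : {rmorphism R -> A}) l ls :
  generated_over iota (l :: ls) -> generated_over (@adjoin_val R A iota l) ls.
Proof.
move=> gen S Scl Sadj Sls; apply: gen => // [r|a].
  have [h] := adjoin_horner iota l r%:P.
  by rewrite map_polyC hornerC => <-.
rewrite inE => /predU1P[->|]; last exact: Sls.
have [h] := adjoin_horner iota l 'X.
by rewrite map_polyX hornerX => <-.
Qed.

Lemma generated_cons (R A : comNzRingType) (iota : R -> A) l ls :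
  generated_over iota ls -> generated_over iota (l :: ls).
Proof.
by move=> gen S Scl SR Sls; apply: gen => // a al; apply: Sls; rewrite inE al orbT.
Qed.

Lemma generated_surj (R A B : comNzRingType) (iota : R -> A) ls
    (pi : {rmorphism A -> B}) :
  (forall b, exists a, pi a = b) -> generated_over iota ls ->
  generated_over (pi \o iota) (map pi ls).
Proof.
move=> surj gen S [S1 SB SM] SR Sls b; have [a <-] := surj b.
have : a \in [pred a | pi a \in S].
  apply: gen => [|r|c cls]; rewrite ?inE.
  - split=> [|u v|u v]; rewrite !inE ?rmorph1 ?rmorphB ?rmorphM //.
      exact: SB.
    exact: SM.
  - exact: SR.
  - by apply: Sls; apply: map_f.
by [].
Qed.

(** * Zariski's lemma *)

Section Zariski.
Variable A : idomainType.

Definition alg_over (R : comNzRingType) (iota : R -> A) (a : A) :=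
  exists2 p : {poly R}, map_poly iota p != 0 & root (map_poly iota p) a.

(* When [S] is the set of nonzero elements of [R], this says that the         *)
(* localization of [A] at [S] is a field; when [S] is [1], that [A] is one.   *)
Definition saturated (R : comNzRingType) (iota : R -> A) (S : R -> Prop) :=
  [/\ S 1, forall s t, S s -> S t -> S (s * t), forall s, S s -> iota s != 0 &
      forall h : A, h != 0 -> exists s a, S s /\ iota s = h * a].

(* The localization of [R] at [S] becomes a field once [g] is inverted.       *)
Definition dividing (R : comNzRingType) (iota : R -> A) (S : R -> Prop) (g : R) :=
  iota g != 0 /\
  forall b, iota b != 0 -> exists s b' m, S s /\ iota (b * b') = iota (s * g ^+ m).

Lemma integral_exp (R : comNzRingType) (iota : {rmorphism R -> A}) a n :
  integralOver iota a -> integralOver iota (a ^+ n).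
Proof.
move=> inta; elim: n => [|n IH]; first exact: integral1.
by rewrite exprS; exact: integral_mul.
Qed.

(** With [d.+1] the degree of [q] and [a] its leading coefficient, [a ^+ d] times the equation of
    [l] is a monic equation for [a * l]. *)
Lemma integral_lead_mul (R : comNzRingType) (iota : {rmorphism R -> A})
    (q : {poly A}) (l : A) :
  (forall i, integralOver iota q`_i) -> root q l ->
  integralOver iota (lead_coef q * l).
Proof.
move=> intq ql.
have [->|q0] := eqVneq q 0; first by rewrite lead_coef0 mul0r; exact: integral0.
have [d sq] : exists d, size q = d.+2.
  have := root_size_gt1 q0 ql; case: (size q) => [|[|d]] // _; by exists d.
set a := lead_coef q.
pose q0' := \poly_(i < d.+1) (q`_i * a ^+ (d - i)).
pose q1 : {poly A} := 'X^(d.+1) + q0'.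
have sz : (size q0' < size ('X^(d.+1) : {poly A})%R)%N.
  by rewrite size_polyXn ltnS size_poly.
apply: (@integral_root_monic _ _ _ _ q1).
- by rewrite monicE lead_coefDl // lead_coefXn.
- rewrite rootE hornerD hornerXn horner_poly.
  rewrite exprMn.
  have -> : \sum_(i < d.+1) q`_i * a ^+ (d - i) * (a * l) ^+ i
            = a ^+ d * \sum_(i < d.+1) q`_i * l ^+ i.
    rewrite mulr_sumr; apply: eq_bigr => i _.
    rewrite exprMn -mulrA [RHS]mulrCA; congr (_ * _).
    by rewrite mulrA -exprD subnK // -ltnS.
  rewrite exprSr -mulrA -mulrDr addrC.
  have -> : \sum_(i < d.+1) q`_i * l ^+ i + a * l ^+ d.+1 = q.[l].
    by rewrite horner_coef sq [RHS]big_ord_recr /= /a /lead_coef sq.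
  by rewrite (rootP ql) mulr0.
apply/integral_poly => i; rewrite coefD coefXn coef_poly.
apply: integral_add; first exact: integral_nat.
case: ifP => _; last exact: integral0.
by apply: integral_mul => //; apply: integral_exp; exact: intq.
Qed.

(** Divide an equation of [t] by ['X] until its constant coefficient [c] is nonzero; all other terms
    are then multiples of [t]. *)
Lemma alg_dvd_base (R : comNzRingType) (iota : {rmorphism R -> A}) (t : A) :
  t != 0 -> alg_over iota t ->
  exists c : R, exists q : {poly R},
    iota c != 0 /\ iota c = t * (map_poly iota q).[t].
Proof.
move=> t0 [p]; elim/poly_ind: p => [|p c IH]; first by rewrite rmorph0 eqxx.
rewrite rmorphD rmorphM /= map_polyX map_polyC /=.
have [-> | c0] := eqVneq (iota c) 0.
  rewrite addr0 rootM rootX (negPf t0) orbF => pX pt.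
  by apply: IH => //; apply: contraNneq pX => ->; rewrite mul0r.
move=> _; rewrite rootE !hornerE => /eqP pt; exists c, (- p); split=> //.
by rewrite rmorphN hornerN mulrN mulrC; apply/eqP; rewrite -addr_eq0 addrC; apply/eqP.
Qed.

Lemma integral_scale (R : comNzRingType) (iota : {rmorphism R -> A}) (a : R) l :
  integralOver iota (iota a * l) -> forall p : {poly R},
  exists e, integralOver iota (iota a ^+ e * (map_poly iota p).[l]).
Proof.
move=> al p; exists (size p).
rewrite (horner_coef_wide _ (size_poly _ _)) mulr_sumr.
elim/big_ind: _ => [|u v|i _]; [exact: integral0 | exact: integral_add |].
have -> : iota a ^+ size p = iota a ^+ (size p - i) * iota a ^+ i.
  by rewrite -exprD subnK // ltnW.
rewrite coef_map mulrCA -mulrA -exprMn; apply: integral_mul; first exact: integral_id.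
apply: integral_mul; first by rewrite -rmorphXn; exact: integral_id.
exact: integral_exp.
Qed.

Lemma saturated_adjoin (R : comNzRingType) (iota : {rmorphism R -> A}) l S :
  saturated iota S ->
  saturated (@adjoin_val R A iota l)
     (fun t => exists2 s, S s & adjoin_val t = iota s).
Proof.
move=> [S1 SM S0 SA]; split=> [|t t' [s Ss e] [s' Ss' e']|t [s Ss ->]|h h0].
- by exists 1; rewrite ?rmorph1.
- by exists (s * s'); [exact: SM|rewrite [LHS]rmorphM /= e e' rmorphM].
- exact: S0.
have [s [a [Ss e]]] := SA h h0.
have [t et] := adjoin_horner iota l s%:P; rewrite map_polyC hornerC in et.
by exists t, a; split; [exists s|rewrite et].
Qed.

(* Otherwise [1 + l g] is a polynomial of positive degree in [l], prime to    *)
(* [g], which cannot divide [s g^m].                                          *)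
Lemma dividing_transc (R : comNzRingType) (iota : {rmorphism R -> A}) l S
    (g : adjoin_ring iota l) :
  saturated iota S ->
  dividing (@adjoin_val R A iota l)
     (fun t => exists2 s, S s & adjoin_val t = iota s) g ->
  alg_over iota l.
Proof.
move=> [S1 SM S0 _] [g0 gdiv]; apply: contrapT => nalg.
have inj (p : {poly R}) : (map_poly iota p).[l] = 0 -> map_poly iota p = 0.
  move=> e; apply/eqP/negPn/negP => p0; apply: nalg; exists p => //.
  exact/rootP.
have [G eG] := adjoin_valP g.
have [b eb] := adjoin_horner iota l (1 + 'X * G).
set f := map_poly iota (1 + 'X * G) in eb.
have G0 : map_poly iota G != 0.
  by apply: contraNneq g0 => e; rewrite eG e horner0.
have ef : f = 1 + 'X * map_poly iota G by rewrite /f rmorphD rmorph1 rmorphM /= map_polyX.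
have szf : (1 < size f)%N.
  have szX : size ('X * map_poly iota G) = (size (map_poly iota G)).+1.
    by rewrite mulrC size_mulX.
  have lt1 : (size (1%R : {poly A}) < size ('X * map_poly iota G)%R)%N.
    by rewrite szX size_poly1 ltnS size_poly_gt0.
  by rewrite ef addrC size_polyDl // szX ltnS size_poly_gt0.
have f0 : f != 0 by rewrite -size_poly_gt0 ltnW.
have b0 : adjoin_val b != 0.
  by rewrite eb; apply: contraNneq f0 => /inj/eqP.
have [t [b' [m [[s Ss et] e]]]] := gdiv b b0.
have [H eH] := adjoin_valP b'.
rewrite !rmorphM rmorphXn /= eb eH et eG in e.
have : (map_poly iota ((1 + 'X * G) * H - s%:P * G ^+ m)).[l] = 0.
  rewrite rmorphB !rmorphM rmorphXn /= -/f map_polyC hornerD hornerN !hornerM.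
  by rewrite horner_exp hornerC e subrr.
move/inj; rewrite rmorphB !rmorphM rmorphXn /= -/f map_polyC /= => /eqP.
rewrite subr_eq0 => /eqP E.
(* Modulo [f], the product of ['X] and the image of [G] is [-1]. Multiplying [E] by ['X^m] thus
   makes [f] divide a nonzero constant. *)
have [w ew] : exists w, ('X * map_poly iota G) ^+ m = f * w + (-1) ^+ m.
  elim: m {E e} => [|m [w IH]]; first by exists 0; rewrite mulr0 add0r !expr0.
  exists (w * ('X * map_poly iota G) + (-1) ^+ m).
  rewrite exprSr IH mulrDl mulrDr -mulrA -addrA; congr (_ + _).
  have -> : 'X * map_poly iota G = f - 1 by rewrite ef addrC addKr.
  by rewrite exprSr mulrBr mulr1 mulrN1 mulrC.
have E2 : f * (map_poly iota H * 'X^m - (iota s)%:P * w) = (iota s)%:P * (-1) ^+ m.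
  rewrite mulrBr mulrA E -mulrA [_ * 'X^m]mulrC -exprMn ew mulrDr.
  by rewrite mulrCA addrC addKr.
have : size ((iota s)%:P * (-1) ^+ m : {poly A}) = 1%N.
  by rewrite mulrC size_Msign size_polyC S0.
rewrite -E2 => szE.
have n0 : map_poly iota H * 'X^m - (iota s)%:P * w != 0.
  apply/eqP => z; by rewrite z mulr0 size_poly0 in szE.
rewrite size_mul // in szE.
move: n0; rewrite -size_poly_gt0 => n0.
case: (size f) szf szE => [|[|k]] // _.
by case: (size _) n0 => [|k'] //; rewrite addnS /= addSn.
Qed.

(* For a suitable [a], [a l] is integral and [g] divides some [c] in [R]. If  *)
(* [b] divides [s c^m] in [R[l]], the quotient times a power of [a] is        *)
(* integral over [R], and its integral equation makes [b] divide a power of   *)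
(* [a s c^m] in [R].                                                          *)
Lemma dividing_alg (R : comNzRingType) (iota : {rmorphism R -> A}) l S
    (g : adjoin_ring iota l) :
  saturated iota S -> alg_over iota l ->
  dividing (@adjoin_val R A iota l)
     (fun t => exists2 s, S s & adjoin_val t = iota s) g ->
  exists g', dividing iota S g'.
Proof.
move=> [S1 SM S0 _] [p p0 pl] [g0 gdiv].
have [a ea] : exists a, iota a = lead_coef (map_poly iota p).
  by exists p`_(size (map_poly iota p)).-1; rewrite /lead_coef coef_map.
have a0 : iota a != 0 by rewrite ea lead_coef_eq0.
have al : integralOver iota (iota a * l).
  by rewrite ea; apply: integral_lead_mul => // i; rewrite coef_map; exact: integral_id.
have scale (h : adjoin_ring iota l) :
    exists e, integralOver iota (iota a ^+ e * adjoin_val h).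
  by have [H ->] := adjoin_valP h; exact: integral_scale.
have [e [q mq rq]] := scale g.
have q0 : map_poly iota q != 0 by apply: monic_neq0; exact: monic_map.
have t0 : iota a ^+ e * adjoin_val g != 0 by rewrite mulf_neq0 ?expf_neq0.
have [c [w [c0 ec]]] := alg_dvd_base t0 (ex_intro2 _ _ q q0 rq).
have [g' eg'] : exists g' : adjoin_ring iota l, iota c = adjoin_val g * adjoin_val g'.
  have [ar ear] := adjoin_horner iota l a%:P; rewrite map_polyC hornerC /= in ear.
  have [G eG] := adjoin_valP g.
  have [y ey] := adjoin_horner iota l (w \Po (a%:P ^+ e * G)).
  exists (ar ^+ e * y); rewrite rmorphM rmorphXn /= ear ey ec.
  rewrite map_comp_poly horner_comp rmorphM rmorphXn /= map_polyC /=.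
  rewrite hornerM horner_exp hornerC -eG.
  by rewrite mulrCA mulrA.
exists (a * c); split; first by rewrite rmorphM mulf_neq0.
move=> b b0.
have [br ebr] := adjoin_horner iota l b%:P; rewrite map_polyC hornerC /= in ebr.
have [|t [b' [m [[s Ss et] E]]]] := gdiv br; first by rewrite ebr.
rewrite !rmorphM rmorphXn /= et ebr in E.
have [e' [r mr rr]] := scale (b' * g' ^+ m).
rewrite rmorphM rmorphXn /= in rr.
set z := (X in root _ X) in rr.
pose beta := a ^+ e' * s * c ^+ m.
have ebeta : iota beta = iota b * z.
  rewrite /beta /z !rmorphM !rmorphXn /= eg' exprMn.
  by rewrite [RHS]mulrCA [iota b * (_ * _)]mulrA E -!mulrA.
have [d sr] : exists d, size r = d.+1.
  by case: (size r) (monic_neq0 mr) (size_poly_eq0 r) => [|d] /negPf-> // _; exists d.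
have smr : size (map_poly iota r) = d.+1.
  by rewrite size_map_poly_id0 // (monicP mr) rmorph1 oner_eq0.
(* Multiplied by [b ^+ d], the monic equation of [z] becomes one for [beta] whose lower terms all
   carry a factor [b]; [b1] is the opposite of their sum, divided by [b]. *)
pose b1 := - \sum_(i < d) r`_i * beta ^+ i * b ^+ (d - i).-1.
have Eb : iota (b * b1) = iota (beta ^+ d).
  have : \sum_(i < d.+1) iota r`_i * z ^+ i = 0.
    move/rootP: rr; rewrite horner_coef smr => E0; rewrite -[RHS]E0.
    by apply: eq_bigr => i _; rewrite coef_map.
  rewrite big_ord_recr /=; have -> : r`_d = 1 by move/monicP: mr; rewrite /lead_coef sr.
  rewrite rmorph1 mul1r => /eqP; rewrite addrC addr_eq0 => /eqP zd.
  rewrite rmorphXn ebeta exprMn zd /b1 mulrN rmorphN mulrN; congr (- _).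
  rewrite mulr_sumr rmorph_sum mulr_sumr; apply: eq_bigr => i _.
  rewrite !rmorphM !rmorphXn ebeta exprMn.
  have -> : iota b ^+ d = iota b * iota b ^+ i * iota b ^+ (d - i).-1.
    by rewrite -exprS -exprD addSnnS prednK ?subnKC // ?subn_gt0 // ltnW.
  by ring.
(* The factors [a ^+ (m * d)] and [c ^+ (e' * d)] equalize the exponents of [a] and [c], which
   leaves a power of [a * c]. *)
exists (s ^+ d), (b1 * (a ^+ (m * d) * c ^+ (e' * d))), (e' * d + m * d)%N; split.
  by elim: (d) => [|k IH]; rewrite ?expr0 ?exprS //; exact: SM.
rewrite mulrA [LHS]rmorphM Eb -rmorphM; congr (iota _).
rewrite /beta !exprMn -!exprM !exprD.
by ring.
Qed.

End Zariski.

(** Induction on the generators: each one is adjoined to the base ring, and the [g] found over the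
    larger ring is brought down by [dividing_alg]. Without generators [iota] is onto and [g = 1]
    works. *)
Lemma exists_dividing (A : idomainType) (ls : seq A) (R : comNzRingType)
    (iota : {rmorphism R -> A}) S :
  generated_over iota ls -> saturated iota S -> exists g, dividing iota S g.
Proof.
elim: ls R iota S => [|l ls IH] R iota S gen sat; last first.
  have [g gdiv] := IH _ _ _ (generated_adjoin gen) (saturated_adjoin l sat).
  exact: dividing_alg sat (dividing_transc sat gdiv) gdiv.
exists 1; split=> [|b b0]; first by rewrite rmorph1 oner_eq0.
have [_ _ _ /(_ _ b0)[s [a [Ss e]]]] := sat.
have : a \in [pred a | `[< exists r, a = iota r >]].
  apply: gen => // [|r]; last by apply/asboolP; exists r.
  split=> [|_ _ /asboolP[u ->] /asboolP[v ->]|_ _ /asboolP[u ->] /asboolP[v ->]];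
    apply/asboolP.
  - by exists 1; rewrite rmorph1.
  - by exists (u - v); rewrite rmorphB.
  - by exists (u * v); rewrite rmorphM.
move=> /asboolP[b' eb]; exists s, b', 0%N; split=> //.
by rewrite expr0 mulr1 rmorphM -eb e.
Qed.

(** With [a] adjoined to the base first, [exists_dividing] provides a [g] over [R[a]], which
    [dividing_transc] forbids when [a] is transcendental. *)
Lemma saturated_alg (A : idomainType) (ls : seq A) (R : comNzRingType)
    (iota : {rmorphism R -> A}) S a :
  generated_over iota ls -> saturated iota S -> alg_over iota a.
Proof.
move=> gen sat.
have gen' := generated_adjoin (generated_cons (l := a) gen).
have [g gdiv] := exists_dividing gen' (saturated_adjoin a sat).
exact: dividing_transc sat gdiv.
Qed.

Lemma intr_char0_eq0 (A : idomainType) (n : int) :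
  [pchar A] =i pred0 -> (n%:~R == 0 :> A) = (n == 0).
Proof.
move=> charA; case: n => n; last rewrite NegzE mulrNz oppr_eq0;
by rewrite -pmulrn (pcharf0P A).1.
Qed.

(** Were [A] a field, there would be a nonzero integer [g] such that every prime divides some power
    of it, even a prime larger than [g] in absolute value. *)
Lemma int_not_saturated (A : idomainType) (ls : seq A) :
  [pchar A] =i pred0 ->
  generated_over (intr : int -> A) ls ->
  ~ saturated (intr : int -> A) (fun n => n = 1).
Proof.
move=> charA gen sat.
have [g [g0 gdiv]] := exists_dividing gen sat.
have intr0 n := intr_char0_eq0 n charA.
rewrite intr0 in g0.
have [p gp pp] := prime_above `|g|.
have [|s [b [m [-> e]]]] := gdiv p.
  by rewrite intr0; case: p pp {gp}.
have : p%:Z * b = g ^+ m.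
  apply/eqP; rewrite -subr_eq0 -intr0 mulrzBr; rewrite e mul1r.
  by rewrite subrr.
move/(congr1 absz); rewrite abszM abszX absz_nat => e'.
have : (p %| `|g| ^ m)%N by rewrite -e' dvdn_mulr.
rewrite Euclid_dvdX // => /andP[/dvdn_leq].
by rewrite absz_gt0 g0 leqNgt gp => /(_ isT).
Qed.

(** * Prime ideals disjoint from a multiplicative set *)

Section PrimeAvoid.
Variables (A : comNzRingType) (S : A -> Prop).

(** By Zorn's lemma some ideal is maximal among those that contain [h] and avoid [S]; such an ideal
    is prime. *)
Lemma prime_avoiding (h : A) :
  S 1 -> (forall s t, S s -> S t -> S (s * t)) -> (forall a, ~ S (h * a)) ->
  exists P : prime_idealr A, h \in (P : pred A) /\ forall s, S s -> s \notin (P : pred A).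
Proof.
move=> S1 SM Sh.
pose good (X : set A) := [/\ X 0, X h, forall u v, X u -> X v -> X (u + v),
  forall a u, X u -> X (a * u) & forall s, S s -> ~ X s].
pose X0 : set A := fun x => exists a, x = a * h.
have gX0 : good X0.
  split=> [||_ _ [a ->] [b ->]|a _ [b ->]|s Ss [a es]].
  - by exists 0; rewrite mul0r.
  - by exists 1; rewrite mul1r.
  - by exists (a + b); rewrite mulrDl.
  - by exists (a * b); rewrite mulrA.
  - by apply: (Sh a); rewrite mulrC -es.
pose P (X : set A) := X = set0 \/ good X.
have [M [PM Mmax]] : exists M, P M /\ forall B, (M `<` B)%classic -> ~ P B.
  apply: Zorn_bigcup => F FP Ftot.
  have [[X FX [x Xx]]|none] := pselect (exists2 X, F X & exists x, X x); last first.
    left; apply/seteqP; split=> // x [X FX Xx]; apply: none; exists X => //; by exists x.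
  have gd Y y : F Y -> Y y -> good Y.
    by move=> FY Yy; have [Y0|//] := FP Y FY; move: Yy; rewrite Y0.
  right; have [gX00 gXh _ _ _] := gd X x FX Xx.
  split; [by exists X|by exists X| | |].
  - move=> u v [Y FY Yu] [Z FZ Zv].
    have [YZ|ZY] := Ftot _ _ FY FZ.
      by exists Z => //; have [_ _ ZD _ _] := gd _ _ FZ Zv; apply: ZD => //; exact: YZ.
    by exists Y => //; have [_ _ YD _ _] := gd _ _ FY Yu; apply: YD => //; exact: ZY.
  - move=> a u [Y FY Yu]; exists Y => //.
    by have [_ _ _ YM _] := gd _ _ FY Yu; exact: YM.
  - by move=> s Ss [Y FY Ys]; have [_ _ _ _ YS] := gd _ _ FY Ys; exact: YS Ss Ys.
have gM : good M.
  case: PM => // M0; exfalso; apply: (Mmax X0); last by right.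
  rewrite M0; split=> // sub; apply: (sub h); exists 1; by rewrite mul1r.
have [M0 Mh MD MM MS] := gM.
(* By maximality the ideal generated by [M] and [x] meets [S]. For [u] and [v] outside [M] with
   product in [M], two such elements of [S] would have their product in [M]. *)
have meets x : ~ M x -> exists s m a, [/\ S s, M m & s = m + a * x].
  move=> nMx; apply: contrapT => nex.
  pose Y : set A := fun y => exists m a, M m /\ y = m + a * x.
  apply: (Mmax Y).
    split=> [u Mu|sub]; first by exists u, 0; rewrite mul0r addr0.
    apply: nMx; apply: sub; exists 0, 1; by rewrite mul1r add0r.
  right; split.
  - by exists 0, 0; rewrite mul0r addr0.
  - by exists h, 0; rewrite mul0r addr0.
  - move=> _ _ [m [a [Mm ->]]] [m' [a' [Mm' ->]]].
    by exists (m + m'), (a + a'); split; [exact: MD|rewrite mulrDl addrACA].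
  - move=> b _ [m [a [Mm ->]]].
    by exists (b * m), (b * a); split; [exact: MM|rewrite mulrDr mulrA].
  - by move=> s Ss [m [a [Mm es]]]; apply: nex; exists s, m, a.
have idM : idealr_closed (fun x => `[< M x >]).
  split; first exact/asboolP.
    by apply/asboolP; exact: MS.
  move=> a u v /asboolP Mu /asboolP Mv; apply/asboolP; apply: MD => //.
  exact: MM.
have prM : prime_idealr_closed (fun x => `[< M x >]).
  move=> u v /asboolP Muv; apply/orP.
  have [Mu|nMu] := pselect (M u); first by left; exact/asboolP.
  have [Mv|nMv] := pselect (M v); first by right; exact/asboolP.
  exfalso.
  have [s [m [a [Ss Mm es]]]] := meets _ nMu.
  have [t [k [b [St Mk et]]]] := meets _ nMv.
  apply: (MS (s * t)); first exact: SM.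
  rewrite es et.
  have -> : (m + a * u) * (k + b * v) = (k + b * v) * m + (a * u * k + a * b * (u * v)).
    by ring.
  by apply: (MD _ _); [exact: MM|apply: MD; exact: MM].
pose I1 := isIdealr.Build A (fun x => `[< M x >]) idM.
pose I2 := isPrimeIdealrClosed.Build A (fun x => `[< M x >]) prM.
pose PM' : prime_idealr A := HB.pack (fun x : A => `[< M x >]) I1 I2.
exists PM'; split; first exact/asboolP.
by move=> s Ss; apply/asboolP; exact: MS.
Qed.

End PrimeAvoid.

Section Kernel.
Variables (A : comNzRingType) (D : idomainType) (f : {rmorphism A -> D}).

Definition ker_pred : {pred A} := fun a => f a == 0.

Lemma ker_pred_idealr_closed : idealr_closed ker_pred.
Proof.
split; rewrite ?unfold_in ?rmorph0 ?rmorph1 ?oner_eq0 //.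
move=> a u v; rewrite !unfold_in => /eqP fu /eqP fv.
by rewrite rmorphD rmorphM fu fv mulr0 addr0.
Qed.

Lemma ker_pred_prime : prime_idealr_closed ker_pred.
Proof. by move=> u v; rewrite !unfold_in rmorphM mulf_eq0. Qed.

HB.instance Definition _ := isIdealr.Build A ker_pred ker_pred_idealr_closed.
HB.instance Definition _ := isPrimeIdealrClosed.Build A ker_pred ker_pred_prime.

Definition ker_ideal : prime_idealr A := ker_pred.

Lemma ker_idealE a : (a \in (ker_ideal : pred A)) = (f a == 0).
Proof. by []. Qed.

End Kernel.

(** If saturation fails, some [h != 0] has no multiple in the image of [S]; divide [D] by a prime
    that contains [h] and avoids this image. *)
Lemma exists_quotient (R : comNzRingType) (D : idomainType)
    (iota : {rmorphism R -> D}) (S : R -> Prop) :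
  S 1 -> (forall s t, S s -> S t -> S (s * t)) -> (forall s, S s -> iota s != 0) ->
  ~ saturated iota S ->
  exists (D' : idomainType) (pi : {rmorphism D -> D'}),
    [/\ forall b, exists a, pi a = b, exists2 h, h != 0 & pi h = 0 &
        forall s, S s -> pi (iota s) != 0].
Proof.
move=> S1 SM S0 nsat.
have [h [h0 Sh]] : exists h, h != 0 /\ forall a s, S s -> iota s <> h * a.
  apply: contrapT => nex; apply: nsat; split=> // h h0.
  apply: contrapT => nex'; apply: nex; exists h; split=> // a s Ss e.
  by apply: nex'; exists s, a.
have [||a [s Ss e]|P [Ph PS]] :=
    @prime_avoiding D (fun d => exists2 s, S s & d = iota s) h.
- by exists 1; rewrite ?rmorph1.
- move=> _ _ [s Ss ->] [t St ->]; exists (s * t); last by rewrite rmorphM.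
  exact: SM.
- exact: Sh Ss (esym e).
pose D' : idomainType := {ideal_quot P}.
pose pi : {rmorphism D -> D'} := \pi_({ideal_quot P})%qT.
have piE d : (pi d == 0) = (d \in (P : pred D)).
  by rewrite -[d in RHS]subr0 Quotient.idealrBE -(rmorph0 pi).
exists D', pi; split=> [b|| s Ss].
- by exists (repr b); rewrite /pi /= reprK.
- by exists h => //; apply/eqP; rewrite piE.
- by rewrite piE; apply: PS; exists s.
Qed.

(** * Evaluation of polynomials, and dependence in Krull dimension two *)

Section Eval.
Variables (R K : comNzRingType) (g : {rmorphism R -> K}).

Definition eval1 (x : K) (p : {poly R}) : K := (map_poly g p).[x].

HB.instance Definition _ x :=
  GRing.RMorphism.copy (eval1 x) (horner_eval x \o map_poly g).

Lemma eval1C x c : eval1 x c%:P = g c.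
Proof. by rewrite /eval1 map_polyC hornerC. Qed.

Lemma eval1X x : eval1 x 'X = x.
Proof. by rewrite /eval1 map_polyX hornerX. Qed.

End Eval.

(** The outer indeterminate takes the value [y], so [size] measures the degree in [y] of a relation
    over [R[x]]. *)
Definition eval2 (R K : comNzRingType) (g : {rmorphism R -> K}) (x y : K) :
  {poly {poly R}} -> K := eval1 (eval1 g x) y.

HB.instance Definition _ R K g x y := GRing.RMorphism.on (@eval2 R K g x y).

Lemma generated_weaken (R R' A : comNzRingType) (iota : R -> A) (iota' : R' -> A) ls :
  (forall r, exists r', iota r = iota' r') ->
  generated_over iota ls -> generated_over iota' ls.
Proof.
by move=> sub gen S Scl SR' Sls; apply: gen => // r; have [r' ->] := sub r.
Qed.

Lemma generated_int (R A : comNzRingType) (iota : {rmorphism R -> A})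
    (iota' : {rmorphism int -> A}) ls :
  generated_over iota' ls -> generated_over iota ls.
Proof.
apply: generated_weaken => n; exists n%:~R.
by rewrite rmorph_int -[n in LHS]intz rmorph_int.
Qed.

Lemma krull_dim_dependent (A : idomainType) (ls : seq A) (a b : A) :
  [pchar A] =i pred0 -> generated_over (intr : int -> A) ls -> krull_dim_eq A 2 ->
  exists2 G : {poly {poly int}}, G != 0 & eval2 intr b a G = 0.
Proof.
move=> charA gen [_ dimA]; apply: contrapT => nodep.
have inj1 (p : {poly int}) : p != 0 -> eval1 intr b p != 0.
  move=> p0; apply/eqP => e; apply: nodep; exists p%:P; first by rewrite polyC_eq0.
  by rewrite /eval2 eval1C.
have mul_neq0 (D : idomainType) : (forall s t : D, s != 0 -> t != 0 -> s * t != 0).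
  by move=> s t; exact: mulf_neq0.
have gen1 : generated_over (eval1 intr b) ls by exact: generated_int gen.
(* If inverting the nonzero elements of [Z[b]] made [A] a field, [a] would be algebraic over
   [Z[b]]. *)
have nsat1 : ~ saturated (eval1 intr b) (fun p => p != 0).
  move=> /(saturated_alg a gen1)[p p0 /rootP pa]; apply: nodep; exists p => //.
  by apply: contraNneq p0 => ->; rewrite rmorph0.
have [D1 [pi1 [surj1 [h1 h10 pih1] pi1S]]] :=
  exists_quotient (oner_neq0 _) (@mul_neq0 _) inj1 nsat1.
have inj2 (n : int) : n != 0 -> n%:~R != 0 :> D1.
  move=> n0; have : n%:P != 0 :> {poly int} by rewrite polyC_eq0.
  by move/pi1S; rewrite /= eval1C rmorph_int.
have gen2 : generated_over (intr : int -> D1) (map pi1 ls).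
  exact/generated_int/(generated_surj surj1 gen).
(* [pi1] is injective on [Z[b]], so the image of [b] in [D1] is still transcendental. *)
have nsat2 : ~ saturated (intr : int -> D1) (fun p => p != 0).
  move=> /(saturated_alg (pi1 b) gen2)[p p0 /rootP pb].
  have /pi1S/eqP[] : p != 0 by apply: contraNneq p0 => ->; rewrite rmorph0.
  rewrite -[RHS]pb /eval1 -horner_map -map_poly_comp.
  by congr (_.[_]); apply: eq_map_poly => n /=; rewrite rmorph_int.
have [D2 [pi2 [surj2 [h2 h20 pih2] pi2S]]] :=
  exists_quotient (oner_neq0 _) (@mul_neq0 _) inj2 nsat2.
have char2 : [pchar D2] =i pred0.
  apply/pcharf0P => -[|n]; first by rewrite !eqxx.
  by have /negPf := pi2S n.+1 isT; rewrite /= -pmulrn rmorph_nat => ->.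
have gen3 : generated_over (intr : int -> D2) (map pi2 (map pi1 ls)).
  exact/generated_int/(generated_surj surj2 gen2).
have nsat3 := int_not_saturated char2 gen3.
have [|||D3 [pi3 [surj3 [h3 h30 pih3] _]]] := exists_quotient _ _ _ nsat3.
- by [].
- by move=> _ _ -> ->.
- by move=> _ ->; rewrite oner_neq0.
(* Lifts to [A] of nonzero elements killed by the next quotient: they make the inclusions between
   the kernels strict. *)
have [k2 ek2] := surj1 h2.
have [k3' ek3'] := surj2 h3; have [k3 ek3] := surj1 k3'.
pose f0 : {rmorphism A -> A} := idfun.
pose f2 : {rmorphism A -> D2} := pi2 \o pi1.
pose f3 : {rmorphism A -> D3} := pi3 \o (pi2 \o pi1).
pose P (i : 'I_4) : prime_idealr A :=
  nth (ker_ideal f0) [:: ker_ideal f0; ker_ideal pi1; ker_ideal f2; ker_ideal f3] i.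
suff : (3 <= 2)%N by [].
apply: (dimA 3 P).
have s01 a' : f0 a' = 0 -> pi1 a' = 0 by move=> /= ->; rewrite rmorph0.
have s12 a' : pi1 a' = 0 -> f2 a' = 0 by move=> /= ->; rewrite rmorph0.
have s23 a' : f2 a' = 0 -> f3 a' = 0 by move=> /= ->; rewrite rmorph0.
have n1 : pi1 h1 = 0 /\ f0 h1 <> 0 by split=> //; exact/eqP.
have n2 : f2 k2 = 0 /\ pi1 k2 <> 0 by rewrite /= ek2; split=> //; exact/eqP.
have n3 : f3 k3 = 0 /\ f2 k3 <> 0 by rewrite /= ek3 ek3'; split=> //; exact/eqP.
have chain (D E : idomainType) (f : {rmorphism A -> D}) (g : {rmorphism A -> E}) x :
    (forall a', f a' = 0 -> g a' = 0) -> g x = 0 /\ f x <> 0 ->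
    {subset (ker_ideal f : pred A) <= (ker_ideal g : pred A)} /\
    ~ {subset (ker_ideal g : pred A) <= (ker_ideal f : pred A)}.
  move=> fg [gx fx]; split=> [y|/(_ x)]; rewrite !ker_idealE.
    by move=> /eqP/fg ->.
  by rewrite gx eqxx => /(_ isT)/eqP.
case=> [[|[|[|[|i]]]] ltI] [[|[|[|[|j]]]] ltJ] //= _.
- exact: chain s01 n1.
- by apply: (chain _ _ f0 f2 k2) => [a' /s01/s12 //|]; split; [case: n2|move/s01; case: n2].
- apply: (chain _ _ f0 f3 k3) => [a' /s01/s12/s23 //|].
  by split; [case: n3|move/s01/s12; case: n3].
- exact: chain s12 n2.
- apply: (chain _ _ pi1 f3 k3) => [a' /s12/s23 //|].
  by split; [case: n3|move/s12; case: n3].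
- exact: chain s23 n3.
Qed.

(** * Relative algebraic closure *)

Section AlgOver.
Variables (R : comNzRingType) (K : fieldType) (iota : {rmorphism R -> K}).

Lemma integral_alg a : integralOver iota a -> alg_over iota a.
Proof. by move=> [p mp pa]; exists p => //; apply: monic_neq0; exact: monic_map. Qed.

(** Multiplication by a leading coefficient turns algebraic elements into integral ones, from which
    the closure properties are inherited. *)
Lemma alg_scaleP a :
  alg_over iota a <-> exists2 z, iota z != 0 & integralOver iota (iota z * a).
Proof.
split=> [[p p0 pa]|[z z0 [p mp pa]]].
  exists p`_(size (map_poly iota p)).-1; rewrite -coef_map.
    by rewrite -lead_coefE lead_coef_eq0.
  rewrite -lead_coefE; apply: integral_lead_mul => // i.
  by rewrite coef_map; exact: integral_id.
have e : map_poly iota (p \Po (z *: 'X)) = map_poly iota p \Po (iota z *: 'X).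
  by rewrite map_comp_poly map_polyZ map_polyX.
exists (p \Po (z *: 'X)); rewrite e.
  rewrite comp_poly2_eq0 ?monic_neq0 ?monic_map //.
  by rewrite size_scale ?size_polyX.
by rewrite rootE horner_comp hornerZ hornerX.
Qed.

Lemma alg_id z : alg_over iota (iota z).
Proof. exact/integral_alg/integral_id. Qed.

Lemma alg_sub a b : alg_over iota a -> alg_over iota b -> alg_over iota (a - b).
Proof.
move=> /alg_scaleP[z z0 az] /alg_scaleP[t t0 bt]; apply/alg_scaleP.
exists (z * t); first by rewrite rmorphM mulf_neq0.
rewrite rmorphM mulrBr -[X in X - _]mulrA mulrCA -mulrA.
by apply: integral_sub; apply: integral_mul => //; exact: integral_id.
Qed.

Lemma alg_mul a b : alg_over iota a -> alg_over iota b -> alg_over iota (a * b).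
Proof.
move=> /alg_scaleP[z z0 az] /alg_scaleP[t t0 bt]; apply/alg_scaleP.
exists (z * t); first by rewrite rmorphM mulf_neq0.
by rewrite rmorphM mulrACA; exact: integral_mul.
Qed.

(** An equation of [a] gives [c = a q(a)] with [c] nonzero in [K], so the inverse is [q(a) / c]. *)
Lemma alg_inv a : alg_over iota a -> alg_over iota a^-1.
Proof.
have [->|a0] := eqVneq a 0; first by rewrite invr0.
move=> alga; have [c [q [c0 ec]]] := alg_dvd_base a0 alga.
have /alg_scaleP[z z0 intza] := alga.
have [e inte] := integral_scale intza q; apply/alg_scaleP.
exists (z ^+ e * c); first by rewrite rmorphM rmorphXn mulf_neq0 ?expf_neq0.
by rewrite rmorphM rmorphXn ec mulrAC -!mulrA mulKf.
Qed.

(** A common multiplier [z] makes all coefficients of [q] integral; then [a] times the leading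
    coefficient is integral, and that coefficient is itself algebraic. *)
Lemma alg_trans (q : {poly K}) a :
  q != 0 -> (forall i, alg_over iota q`_i) -> root q a -> alg_over iota a.
Proof.
move=> q0 algq qa.
have [z [z0 intz]] : exists z, iota z != 0 /\ forall i, integralOver iota (iota z * q`_i).
  have [z [z0 intz]] : exists z, iota z != 0 /\
      forall i, (i < size q)%N -> integralOver iota (iota z * q`_i).
    elim: (size q) => [|n [z [z0 IH]]]; first by exists 1; rewrite rmorph1 oner_neq0.
    have /alg_scaleP[t t0 intt] := algq n.
    exists (t * z); split=> [|i]; first by rewrite rmorphM mulf_neq0.
    rewrite ltnS leq_eqVlt rmorphM => /predU1P[->|ltin].
      by rewrite mulrAC mulrC; apply: integral_mul => //; exact: integral_id.
    by rewrite -mulrA; apply: integral_mul; [exact: integral_id|exact: IH].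
  exists z; split=> // i; have [/intz//|ge] := ltnP i (size q).
  by rewrite nth_default // mulr0; exact: integral0.
have : integralOver iota (lead_coef (iota z *: q) * a).
  by apply: integral_lead_mul => [i|]; rewrite ?coefZ // rootZ.
move/integral_alg => alga.
rewrite -[a](mulKf (_ : lead_coef (iota z *: q) != 0)) //.
  apply: alg_mul => //; apply: alg_inv; rewrite lead_coefZ.
  by apply: alg_mul; [exact: alg_id|exact: algq].
by rewrite lead_coef_eq0 scaler_eq0 negb_or z0.
Qed.

End AlgOver.

Section RelAlgClosure.
Variable K : fieldType.

(** In characteristic zero, the algebraic closure of the rationals in [K]. It serves as field of
    constants, so that an algebraic logarithmic derivative is a constant. *)
Definition rel_alg : {pred K} := fun a => `[< alg_over (intr : int -> K) a >].

Lemma rel_algP a : reflect (alg_over (intr : int -> K) a) (a \in rel_alg).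
Proof. exact: asboolP. Qed.

Lemma rel_alg_divring_closed : divring_closed rel_alg.
Proof.
split=> [|a b /rel_algP alga /rel_algP algb|a b /rel_algP alga /rel_algP algb];
  apply/rel_algP.
- exact: (alg_id _ 1).
- exact: alg_sub.
- by apply: alg_mul => //; exact: alg_inv.
Qed.

HB.instance Definition _ :=
  GRing.isDivringClosed.Build K rel_alg rel_alg_divring_closed.

Definition rel_alg_field : Type := {a : K | a \in rel_alg}.

HB.instance Definition _ := SubChoice.on rel_alg_field.
HB.instance Definition _ := [SubChoice_isSubIntegralDomain of rel_alg_field by <:].
HB.instance Definition _ := [SubIntegralDomain_isSubField of rel_alg_field by <:].

Definition rel_alg_val : rel_alg_field -> K := val.
HB.instance Definition _ := GRing.RMorphism.on rel_alg_val.

Lemma rel_alg_exists a : alg_over (intr : int -> K) a -> exists u, rel_alg_val u = a.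
Proof.
move=> alga; have ha : a \in rel_alg by exact/rel_algP.
by exists (exist (fun a => a \in rel_alg) a ha).
Qed.

Lemma rel_alg_trans (p : {poly rel_alg_field}) a :
  p != 0 -> root (map_poly rel_alg_val p) a -> alg_over (intr : int -> K) a.
Proof.
move=> p0; apply: alg_trans; first by rewrite map_poly_eq0.
by move=> i; rewrite coef_map; apply/rel_algP; exact: valP.
Qed.

End RelAlgClosure.

(** * Logarithmic derivatives *)

Section EvalTheory.
Variables (R K : comNzRingType) (g : {rmorphism R -> K}).

Lemma eval1_morph (L : comNzRingType) (h : {rmorphism K -> L})
    (g' : {rmorphism R -> L}) x p :
  (forall c, h (g c) = g' c) -> h (eval1 g x p) = eval1 g' (h x) p.
Proof.
move=> hg; rewrite /eval1 -horner_map -map_poly_comp.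
by congr (_.[_]); apply: eq_map_poly.
Qed.

Lemma eval1_wide x (p : {poly R}) n :
  (size p <= n)%N -> eval1 g x p = \sum_(i < n) g p`_i * x ^+ i.
Proof.
move=> le; rewrite /eval1 (horner_coef_wide _ (leq_trans (size_poly _ _) le)).
by apply: eq_bigr => i _; rewrite coef_map.
Qed.

Lemma eval2C x y p : eval2 g x y p%:P = eval1 g x p.
Proof. exact: eval1C. Qed.

Lemma eval2X x y : eval2 g x y 'X = y.
Proof. exact: eval1X. Qed.

Lemma eval2_mapC x w (p : {poly R}) : eval2 g x w (map_poly polyC p) =
  eval1 g w p.
Proof.
rewrite /eval2 /eval1 -map_poly_comp; congr (_.[_]).
by apply: eq_map_poly => c /=; rewrite eval1C.
Qed.

Lemma eval2_at0 x (G : {poly {poly R}}) : eval2 g x 0 G = eval1 g x G`_0.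
Proof. by rewrite /eval2 {1}/eval1 horner_coef0 coef_map. Qed.

Lemma eval2B x y (G H : {poly {poly R}}) :
  eval2 g x y (G - H) = eval2 g x y G - eval2 g x y H.
Proof. exact: raddfB. Qed.

Lemma eval2N x y (G : {poly {poly R}}) : eval2 g x y (- G) = - eval2 g x y G.
Proof. exact: raddfN. Qed.

Lemma eval2D x y (G H : {poly {poly R}}) :
  eval2 g x y (G + H) = eval2 g x y G + eval2 g x y H.
Proof. exact: rmorphD. Qed.

Lemma eval2M x y (G H : {poly {poly R}}) :
  eval2 g x y (G * H) = eval2 g x y G * eval2 g x y H.
Proof. exact: rmorphM. Qed.

Lemma eval2Xn x y (G : {poly {poly R}}) n :
  eval2 g x y (G ^+ n) = eval2 g x y G ^+ n.
Proof. exact: rmorphXn. Qed.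

Lemma eval1M x (p q : {poly R}) : eval1 g x (p * q) = eval1 g x p * eval1 g x q.
Proof. exact: rmorphM. Qed.

Lemma eval1D x (p q : {poly R}) : eval1 g x (p + q) = eval1 g x p + eval1 g x q.
Proof. exact: rmorphD. Qed.

Lemma eval1Xn x (p : {poly R}) n : eval1 g x (p ^+ n) = eval1 g x p ^+ n.
Proof. exact: rmorphXn. Qed.

Lemma eval2Z x y p (G : {poly {poly R}}) :
  eval2 g x y (p *: G) = eval1 g x p * eval2 g x y G.
Proof. by rewrite -mul_polyC eval2M eval2C. Qed.

Lemma eval2_wide x y (G : {poly {poly R}}) n :
  (size G <= n)%N -> eval2 g x y G = \sum_(i < n) eval1 g x G`_i * y ^+ i.
Proof.
move=> le; rewrite /eval2 /eval1 (horner_coef_wide _ (leq_trans (size_poly _ _) le)).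
by apply: eq_bigr => i _; rewrite coef_map.
Qed.

End EvalTheory.

Lemma eval2_morph (R K L : comNzRingType) (g : {rmorphism R -> K})
    (h : {rmorphism K -> L}) (g' : {rmorphism R -> L}) x y G :
  (forall c, h (g c) = g' c) -> h (eval2 g x y G) = eval2 g' (h x) (h y) G.
Proof. by move=> hg; apply: eval1_morph => p; exact: eval1_morph. Qed.

(** The partial derivative in the inner indeterminate; [deriv] is the one in the outer. *)
Definition derivU (R : nzRingType) (G : {poly {poly R}}) : {poly {poly R}} :=
  map_poly (@deriv R) G.

Lemma derivU_poly (R : nzRingType) (G : {poly {poly R}}) p :
  derivU (G * 'X + p%:P) = derivU G * 'X + (p^`())%:P.
Proof.
apply/polyP => i; rewrite !(coef_map, coefD, coefMX, coefC) /= derivD.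
by case: i => [|i] //=; rewrite ?deriv0 ?add0r.
Qed.

(** * First-order expansions *)

Section Taylor.
Variables (R K : comNzRingType) (g : {rmorphism R -> K}).

Let gC : {rmorphism R -> {poly K}} := polyC \o g.

Lemma coef0_eval2 (X Y : {poly K}) G : (eval2 gC X Y G)`_0 = eval2 g X`_0 Y`_0 G.
Proof.
by apply: (eval2_morph (h := coefp 0)) => c; rewrite /= coefC.
Qed.

Lemma coef0_eval1 (X : {poly K}) p : (eval1 gC X p)`_0 = eval1 g X`_0 p.
Proof.
by apply: (eval1_morph (h := coefp 0)) => c; rewrite /= coefC.
Qed.

Lemma coef1M (p q : {poly K}) : (p * q)`_1 = p`_0 * q`_1 + p`_1 * q`_0.
Proof. by rewrite coefM !big_ord_recl big_ord0 addr0. Qed.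

Lemma coef1_eval1 (X : {poly K}) p : (eval1 gC X p)`_1 = X`_1 * eval1 g X`_0 p^`().
Proof.
elim/poly_ind: p => [|p c IH]; first by rewrite deriv0 !rmorph0 coef0 mulr0.
rewrite rmorphD rmorphM /= eval1X eval1C coefD coefC addr0 coef1M IH coef0_eval1.
rewrite derivD derivM derivX derivC addr0 mulr1 rmorphD rmorphM /= eval1X; ring.
Qed.

(** The chain rule, read off modulo the square of the indeterminate; derivations are handled through
    such expansions only. *)
Lemma coef1_eval2 (X Y : {poly K}) G :
  (eval2 gC X Y G)`_1 = X`_1 * eval2 g X`_0 Y`_0 (derivU G)
                      + Y`_1 * eval2 g X`_0 Y`_0 G^`().
Proof.
elim/poly_ind: G => [|G p IH].
  by rewrite deriv0 /derivU map_poly0 !rmorph0 coef0 !mulr0 addr0.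
rewrite rmorphD rmorphM /= eval2X eval2C coefD coef1M IH coef1_eval1 coef0_eval2.
rewrite derivU_poly derivD derivM derivX derivC addr0 mulr1.
by rewrite !rmorphD !rmorphM /= !eval2X !eval2C; ring.
Qed.

End Taylor.

Lemma coef1_exp (K : comNzRingType) (X : {poly K}) c n :
  X`_1 = c * X`_0 -> (X ^+ n)`_1 = n%:R * c * X`_0 ^+ n.
Proof.
move=> e; have e0 m : (X ^+ m)`_0 = X`_0 ^+ m by rewrite -!/(coefp 0 _) rmorphXn.
elim: n => [|n IH]; first by rewrite expr0 coefC !mul0r.
by rewrite exprS coef1M IH e e0 exprS -natr1; ring.
Qed.

(* [r] is [(D y)/y] for the derivation [D] of the field generated by [x] and  *)
(* [y] over [k] such that [D x = x]; only the compatibility of [D] with the   *)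
(* algebraic relations between [x] and [y] is recorded.                       *)
Definition log_deriv (k K : comNzRingType) (iota : {rmorphism k -> K}) (x y r : K) :=
  forall G : {poly {poly k}}, eval2 iota x y G = 0 ->
    x * eval2 iota x y (derivU G) + r * y * eval2 iota x y G^`() = 0.

(** The derivation sends [x^a] to [a x^a] and [y^b] to [b r y^b]. Substituting powers in [G] gives a
    relation [W] between [x] and [y], whose first-order term is computed in two ways. *)
Lemma log_deriv_exp (k K R : comNzRingType) (iota : {rmorphism k -> K})
    (g : {rmorphism R -> k}) (g' : {rmorphism R -> K}) x y r a b G :
  (forall c, iota (g c) = g' c) -> log_deriv iota x y r ->
  eval2 g' (x ^+ a) (y ^+ b) G = 0 ->
  a%:R * x ^+ a * eval2 g' (x ^+ a) (y ^+ b) (derivU G) +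
  b%:R * r * y ^+ b * eval2 g' (x ^+ a) (y ^+ b) G^`() = 0.
Proof.
move=> hg der G0.
pose gg : {rmorphism R -> {poly {poly k}}} := polyC \o (polyC \o g).
pose W := eval2 gg ('X^a)%:P 'X^b G.
have W0 : eval2 iota x y W = 0.
  rewrite -[RHS]G0 (eval2_morph (g' := g')) => [|c /=]; last by rewrite eval2C eval1C.
  by rewrite /= eval2C !rmorphXn /= eval1X eval2X.
pose X : {poly K} := x%:P + x%:P * 'X; pose Y : {poly K} := y%:P + (r * y)%:P * 'X.
have X0 : X`_0 = x by rewrite coefD coefC coefMX addr0.
have X1 : X`_1 = 1 * X`_0 by rewrite X0 coefD coefMX !coefC add0r mul1r.
have Y0 : Y`_0 = y by rewrite coefD coefC coefMX addr0.
have Y1 : Y`_1 = r * Y`_0 by rewrite Y0 coefD coefMX !coefC add0r.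
have := coef1_eval2 iota X Y W; rewrite X1 Y1 X0 Y0 mul1r (der _ W0).
rewrite (eval2_morph (g' := polyC \o g')) => [|c /=]; last first.
  by rewrite eval2C eval1C /= hg.
rewrite /= eval2C !rmorphXn /= eval1X eval2X coef1_eval2.
rewrite !(coef1_exp _ X1) !(coef1_exp _ Y1) -!/(coefp 0 _) !rmorphXn /= X0 Y0 mulr1.
exact.
Qed.

(** * Relations of minimal degree *)

Section MinimalRelation.
Variables (R : idomainType) (K : idomainType) (g : {rmorphism R -> K}).

Definition transcendental (x : K) := forall p : {poly R}, eval1 g x p = 0 -> p = 0.

Definition minimal_relation (x y : K) (P : {poly {poly R}}) :=
  [/\ P != 0, eval2 g x y P = 0 &
      forall G, eval2 g x y G = 0 -> (size G < size P)%N -> G = 0].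

Lemma exists_minimal_relation x y G :
  G != 0 -> eval2 g x y G = 0 -> exists P, minimal_relation x y P.
Proof.
elim: {G}(size G) {-2}G (leqnn (size G)) => [|n IH] G.
  by rewrite leqn0 size_poly_eq0 => ->.
move=> szG G0 eG.
have [[H [H0 eH szH]]|none] :=
    pselect (exists H, [/\ H != 0, eval2 g x y H = 0 & (size H < size G)%N]).
  by apply: (IH H) => //; rewrite -ltnS (leq_trans szH).
exists G; split=> // H eH szH; apply/eqP/negPn/negP => H0.
by apply: none; exists H.
Qed.

(** Since [G] vanishes at the point, only the remainders modulo [G] matter; the sum of the
    individual exponents serves all [H i] at once. *)
Lemma pseudo_division (I : finType) (H : I -> {poly {poly R}}) x y G :
  G != 0 -> eval2 g x y G = 0 ->
  exists S (t : I -> {poly {poly R}}), forall i,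
    (size (t i) < size G)%N /\
    eval1 g x (lead_coef G) ^+ S * eval2 g x y (H i) = eval2 g x y (t i).
Proof.
move=> G0 eG.
pose s i := Pdiv.IdomainDefs.scalp (H i) G.
exists (\sum_i s i)%N.
exists (fun i => lead_coef G ^+ (\sum_j s j - s i) *: Pdiv.IdomainDefs.modp (H i) G).
move=> i; split.
  by apply: leq_ltn_trans (size_scale_leq _ _) _; rewrite Pdiv.CommonIdomain.ltn_modp.
have := congr1 (eval2 g x y) (Pdiv.WeakIdomain.divp_eq (H i) G).
rewrite rmorphD rmorphM /= eG mulr0 add0r -!mul_polyC !rmorphM /= !eval2C !rmorphXn => <-.
rewrite mulrA -exprD subnK //.
by rewrite (bigD1 i) //= leq_addr.
Qed.

Lemma minimal_size x y P :
  transcendental x -> minimal_relation x y P -> (1 < size P)%N.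
Proof.
move=> tx [P0 eP _]; rewrite ltnNge; apply/negP => /size1_polyC eC.
move: eP; rewrite eC eval2C => /tx p0; by rewrite eC p0 polyC0 eqxx in P0.
Qed.

Lemma minimal_coef0 x y P :
  y != 0 -> minimal_relation x y P -> P`_0 != 0.
Proof.
move=> y0 [P0 eP minP]; apply/eqP => e.
have [Q eQ] : exists Q, P = Q * 'X.
  elim/poly_ind: P P0 eP minP e => [|Q c _ _ _ _]; first by rewrite eqxx.
  by rewrite coefD coefMX coefC add0r => ->; exists Q; rewrite polyC0 addr0.
have Q0 : Q != 0 by apply: contraNneq P0 => z; rewrite eQ z mul0r.
move: eP; rewrite eQ rmorphM /= eval2X => /eqP.
rewrite mulf_eq0 (negPf y0) orbF => /eqP/minP eQ0.
have szQ : (size Q < size P)%N by rewrite eQ size_mulX.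
by move: Q0; rewrite (eQ0 szQ) eqxx.
Qed.

(** The derivative is shorter than [P], so by minimality it could vanish only by being zero, which
    characteristic zero excludes. *)
Lemma minimal_deriv_neq0 : [pchar R] =i pred0 -> forall x y P,
  transcendental x -> minimal_relation x y P -> eval2 g x y P^`() != 0.
Proof.
move=> charR x y P tx minP; have szP := minimal_size tx minP.
have [P0 eP min] := minP.
have [d sP] : exists d, size P = d.+2.
  by case: (size P) szP => [|[|d]] // _; exists d.
have charP : [pchar {poly R}] =i pred0 by move=> p; rewrite pchar_poly charR.
apply/eqP => /min/(_ (lt_size_deriv P0))/(congr1 (fun Q : {poly {poly R}} => Q`_d)).
rewrite coef_deriv coef0 => /eqP; rewrite -mulr_natr mulf_eq0 ((pcharf0P _).1 charP) orbF.
by move: P0; rewrite -lead_coef_eq0 lead_coefE sP => /negPf ->.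
Qed.

End MinimalRelation.

Section LogDeriv.
Variables (k K : fieldType) (iota : {rmorphism k -> K}).
Hypothesis chark : [pchar k] =i pred0.

Lemma transc_neq0 x (p : {poly k}) :
  transcendental iota x -> p != 0 -> eval1 iota x p != 0.
Proof. by move=> tx; apply: contraNneq => /tx ->. Qed.

(** The relation [P] forces the value of [r]. Any other relation is a multiple of [P] up to a power
    of the leading coefficient, and the product rule carries the compatibility over to it. *)
Lemma exists_log_deriv x y P :
  y != 0 -> transcendental iota x -> minimal_relation iota x y P ->
  exists r, log_deriv iota x y r.
Proof.
move=> y0 tx minP; have dP := minimal_deriv_neq0 chark tx minP.
have [P0 eP min] := minP.
set b := eval2 iota x y P^`() in dP.
exists (- (x * eval2 iota x y (derivU P)) / (y * b)) => G eG.
set r := _ / _.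
have rP : x * eval2 iota x y (derivU P) + r * y * b = 0.
  by rewrite /r -mulrA divfK ?subrr // mulf_neq0.
pose X : {poly K} := x%:P + x%:P * 'X; pose Y : {poly K} := y%:P + (r * y)%:P * 'X.
have X0 : X`_0 = x by rewrite coefD coefC coefMX addr0.
have X1 : X`_1 = x by rewrite coefD coefMX !coefC add0r.
have Y0 : Y`_0 = y by rewrite coefD coefC coefMX addr0.
have Y1 : Y`_1 = r * y by rewrite coefD coefMX !coefC add0r.
have c1 H := coef1_eval2 iota X Y H; rewrite X0 X1 Y0 Y1 in c1.
have c0 H := coef0_eval2 iota X Y H; rewrite X0 Y0 in c0.
rewrite -c1.
have e := Pdiv.WeakIdomain.divp_eq G P.
have lead0 : eval1 iota x (lead_coef P) != 0 by rewrite transc_neq0 ?lead_coef_eq0.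
have mod0 : Pdiv.IdomainDefs.modp G P = 0.
  apply: min; last by rewrite Pdiv.CommonIdomain.ltn_modp.
  move/(congr1 (eval2 iota x y)): e.
  by rewrite rmorphD rmorphM /= eP -mul_polyC rmorphM /= eG !mulr0 add0r.
move: e; rewrite mod0 addr0 -mul_polyC => e.
have := congr1 (fun Q => (eval2 (polyC \o iota) X Y Q)`_1) e.
rewrite !rmorphM /= !coef1M !c0 eP eG !mulr0 !addr0 eval2C (c1 P) rP mulr0.
by move/eqP; rewrite mulf_eq0 rmorphXn expf_eq0 (negPf lead0) andbF /= => /eqP.
Qed.

End LogDeriv.

Lemma coefM_top (R : nzRingType) (p q : {poly R}) m n :
  (size p <= m.+1)%N -> (size q <= n.+1)%N -> (p * q)`_(m + n) = p`_m * q`_n.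
Proof.
move=> szp szq; have lt : (m < (m + n).+1)%N by rewrite ltnS leq_addr.
rewrite coefM (bigD1 (Ordinal lt)) //= addKn big1 ?addr0 // => i.
rewrite -val_eqE /= neq_ltn => /orP[lti|gti].
  by rewrite [q`__]nth_default ?mulr0 // (leq_trans szq) // ltn_subRL ltn_add2r.
by rewrite nth_default ?mul0r // (leq_trans szp).
Qed.

(** * The Euler operator on polynomials *)

Section EulerOperator.
Variable k : fieldType.
Hypothesis chark : [pchar k] =i pred0.
Implicit Types a b p : {poly k}.

Definition euler p : {poly k} := 'X * p^`().

Lemma coef_euler p i : (euler p)`_i = i%:R * p`_i.
Proof.
rewrite coefXM; case: i => [|i] /=; first by rewrite mul0r.
by rewrite coef_deriv mulr_natl.
Qed.

Lemma size_euler p : (size (euler p) <= size p)%N.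
Proof. by apply/leq_sizeP => i le; rewrite coef_euler nth_default ?mulr0. Qed.

Lemma eulerM p q : euler (p * q) = euler p * q + p * euler q.
Proof. rewrite /euler derivM; ring. Qed.

Lemma eulerXn n : euler 'X^n = n%:R *: 'X^n.
Proof.
apply/polyP => i; rewrite coef_euler coefZ coefXn.
by case: eqP => [->|]; rewrite ?mulr0.
Qed.

Lemma natr_inj m n : m%:R = n%:R :> k -> m = n.
Proof.
wlog le : m n / (m <= n)%N => [H|] e.
  by case: (leqP m n) => [/H->//|/ltnW/H->].
have /eqP : (n - m)%:R = 0 :> k by rewrite natrB // e subrr.
by rewrite ((pcharf0P _).1 chark) subn_eq0 => le'; apply/eqP; rewrite eqn_leq le.
Qed.

(** Compare top coefficients: the Euler operator multiplies a leading coefficient by the degree. *)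
Lemma euler_degree a b (c : k) : a != 0 -> b != 0 ->
  b * euler a = (euler b + c *: b) * a ->
  (size a).-1%:R = (size b).-1%:R + c.
Proof.
move=> a0 b0 e.
have sa : (size a <= (size a).-1.+1)%N by rewrite leqSpred.
have sb : (size b <= (size b).-1.+1)%N by rewrite leqSpred.
have sea := leq_trans (size_euler a) sa.
have sc : (size (euler b + c *: b)%R <= (size b).-1.+1)%N.
  rewrite (leq_trans (size_polyD _ _)) // geq_max (leq_trans (size_euler b)) //=.
  exact: leq_trans (size_scale_leq _ _) sb.
have := congr1 (fun p : {poly k} => p`_((size b).-1 + (size a).-1)) e.
rewrite !coefM_top // coefD coefZ !coef_euler -!lead_coefE => e'.
have la : lead_coef a != 0 by rewrite lead_coef_eq0.
have lb : lead_coef b != 0 by rewrite lead_coef_eq0.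
apply: (mulIf la); apply: (mulfI lb); rewrite e'; ring.
Qed.

(** The derivative of [a / b] is zero. Every nonzero solution has the degree of [b], while
    subtracting a suitable multiple of [b] from [a] cancels the coefficient in that degree. *)
Lemma euler_proportional a b : b != 0 ->
  b * euler a = a * euler b -> exists c, a = c *: b.
Proof.
move=> b0 e; have [->|a0] := eqVneq a 0; first by exists 0; rewrite scale0r.
have lb : lead_coef b != 0 by rewrite lead_coef_eq0.
have eq_size s : s != 0 -> b * euler s = s * euler b -> (size s).-1 = (size b).-1.
  move=> s0 es; apply: natr_inj; rewrite -[RHS]addr0; apply: euler_degree => //.
  by rewrite scale0r addr0 es mulrC.
pose c := lead_coef a / lead_coef b; pose s := a - c *: b.
exists c; apply/eqP; rewrite -subr_eq0 -/s; apply/negPn/negP => s0.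
have es : b * euler s = s * euler b.
  have -> : euler s = euler a - c *: euler b.
    by rewrite /euler /s derivB derivZ mulrBr scalerAr.
  by rewrite mulrBr e /s -!mul_polyC; ring.
have := lead_coef_eq0 s; rewrite (negPf s0) lead_coefE (eq_size s s0 es).
rewrite /s coefB coefZ -lead_coefE -(eq_size a a0 e) -lead_coefE /c divfK //.
by rewrite subrr eqxx.
Qed.

(** The equation says that [a * 'X^N] and [b * 'X^M] have the same logarithmic derivative. *)
Lemma euler_homogeneous a b N M : b != 0 ->
  b * euler a + N%:R *: (a * b) = a * euler b + M%:R *: (a * b) ->
  exists c, a * 'X^N = c *: (b * 'X^M).
Proof.
move=> b0 e; apply: euler_proportional; first by rewrite mulf_neq0 // monic_neq0 ?monicXn.
rewrite !eulerM !eulerXn.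
have -> : b * 'X^M * (euler a * 'X^N + a * (N%:R *: 'X^N)) =
   'X^M * 'X^N * (b * euler a + N%:R *: (a * b)).
  by rewrite -!mul_polyC; ring.
by rewrite e -!mul_polyC; ring.
Qed.

End EulerOperator.

(** * Algebraic logarithmic derivatives *)

Section AlgebraicLogDeriv.
Variables (k K : fieldType) (iota : {rmorphism k -> K}).
Hypothesis chark : [pchar k] =i pred0.
Variables (x y : K) (P : {poly {poly k}}).
Hypotheses (x0 : x != 0) (y0 : y != 0) (tx : transcendental iota x)
  (minP : minimal_relation iota x y P).

Let d := (size P).-1.

(** Differentiating [P(x, y) = 0] gives a relation [Q] of degree at most [d] in [y]; cancelling the
    top term against [P] leaves a shorter relation, zero by minimality. *)
Lemma minimal_euler (rho : k) : log_deriv iota x y (iota rho) -> forall j,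
  P`_d * (euler P`_j + (rho * j%:R) *: P`_j) =
  (euler P`_d + (rho * d%:R) *: P`_d) * P`_j.
Proof.
move=> der; have [P0 eP min] := minP.
have [Q [Qj eQ]] : exists Q : {poly {poly k}},
    (forall j, Q`_j = euler P`_j + (rho * j%:R) *: P`_j) /\ eval2 iota x y Q = 0.
  exists ('X%:P * derivU P + rho%:P%:P * ('X * P^`())); split=> [j|].
    rewrite coefD !coefCM coef_map /= -/(euler _); congr (_ + _).
    rewrite coefXM; case: j => [|j] /=; first by rewrite !mulr0 scale0r.
    rewrite coef_deriv -mul_polyC polyCM -mulrA; congr (_ * _).
    by rewrite polyC_natr mulr_natl.
  rewrite eval2D !eval2M !eval2C eval2X eval1X eval1C.
  by rewrite mulrA der.
have eZ : eval2 iota x y (P`_d *: Q - Q`_d *: P) = 0.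
  by rewrite eval2B !eval2Z eP eQ !mulr0 subrr.
have szP : size P = d.+1 by rewrite /d prednK // size_poly_gt0.
have szZ : (size (P`_d *: Q - Q`_d *: P)%R < size P)%N.
  rewrite szP ltnS; apply/leq_sizeP => j; rewrite leq_eqVlt => /predU1P[<-|lt].
    by rewrite coefB !coefZ mulrC subrr.
  rewrite coefB !coefZ (Qj j) [P`_j]nth_default ?szP //.
  by rewrite /euler deriv0 scaler0 !mulr0 addr0 mulr0 subrr.
move=> j; have := congr1 (fun G : {poly {poly k}} => G`_j) (min _ eZ szZ).
by rewrite coef0 coefB !coefZ !Qj => /eqP; rewrite subr_eq0 => /eqP.
Qed.

(** For [j = 0], [minimal_euler] compares degrees: [rho * d] is the degree of the constant
    coefficient of [P] minus that of the leading one. *)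
Lemma log_deriv_rational (rho : k) : log_deriv iota x y (iota rho) ->
  exists d' m n : nat, (0 < d')%N /\ rho * d'%:R = m%:R - n%:R.
Proof.
move=> der; have [P0 eP min] := minP.
have := minimal_euler der 0; rewrite mulr0 scale0r addr0 => E.
have pd0 : P`_d != 0 by rewrite /d -lead_coefE lead_coef_eq0.
have H := euler_degree (minimal_coef0 y0 minP) pd0 E.
exists d, (size P`_0).-1, (size P`_d).-1; split.
  by rewrite /d; case: (size P) (minimal_size tx minP) => [|[]].
by rewrite H [X in X - _]addrC addrK.
Qed.

(** The coefficient of index [j] of [P] is the leading one times [c j] and [x^((m - n)(d - j))], so
    [P(x, y) = 0] becomes an equation over [k] for [y x^n / x^m]. In [hom] both sides are multiplied
    up to keep the exponents natural. *)
Lemma log_deriv_integer (m n : nat) : log_deriv iota x y (m%:R - n%:R) ->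
  alg_over iota (y * x ^+ n / x ^+ m).
Proof.
move=> der; have [P0 eP min] := minP.
have szP : size P = d.+1 by rewrite /d prednK // size_poly_gt0.
have pd0 : P`_d != 0 by rewrite /d -lead_coefE lead_coef_eq0.
have der' : log_deriv iota x y (iota (m%:R - n%:R)) by rewrite rmorphB !rmorph_nat.
have hom j : exists c, P`_j * 'X^(m * j + n * d) = c *: (P`_d * 'X^(m * d + n * j)).
  apply: euler_homogeneous => //.
  have := minimal_euler der' j; rewrite -!mul_polyC => E.
  rewrite !natrD !natrM.
  move: E; rewrite !(polyCD, polyCM, polyCN, polyC_natr) => E.
  have -> : P`_d * euler P`_j = (euler P`_d + (m%:R - n%:R) * d%:R * P`_d) * P`_j
      - P`_d * ((m%:R - n%:R) * j%:R * P`_j) by rewrite -E; ring.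
  ring.
have [c hc] := boolp.choice hom.
set Z := y * _ / _.
have cd : c d = 1.
  have := hc d; rewrite addnC [X in 'X^X]addnC -mul_polyC => /eqP.
  rewrite -[X in X == _]mul1r -subr_eq0 -mulrBl mulf_eq0.
  rewrite [P`_d * _ == 0]mulf_eq0 (negPf pd0) /= (negPf (monic_neq0 (monicXn _ _))) orbF.
  by rewrite subr_eq0 -polyC1 => /eqP/polyC_inj.
pose p := \poly_(j < d.+1) c j.
exists p.
  rewrite map_poly_eq0; apply/eqP => /(congr1 (fun q : {poly k} => q`_d)).
  by rewrite coef_poly ltnSn cd coef0 => /eqP; rewrite oner_eq0.
rewrite rootE -/(eval1 iota Z p) (eval1_wide _ _ (size_poly _ _)).
have pdx : eval1 iota x P`_d != 0 by rewrite transc_neq0.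
have U0 : eval1 iota x P`_d * x ^+ (m * d) != 0 by rewrite mulf_neq0 ?expf_neq0.
rewrite -(mulrI_eq0 _ (mulfI U0)) mulr_sumr.
suff -> : \sum_(i < d.+1) eval1 iota x P`_d * x ^+ (m * d) * (iota p`_i * Z ^+ i) =
    x ^+ (n * d) * eval2 iota x y P by rewrite eP mulr0.
rewrite (@eval2_wide _ _ iota x y P d.+1) ?szP // mulr_sumr.
apply: eq_bigr => i _; rewrite coef_poly ltn_ord.
have := congr1 (eval1 iota x) (hc i).
rewrite -mul_polyC !eval1M !eval1Xn !eval1X eval1C !exprD => E.
rewrite /Z expr_div_n exprMn -!exprM.
have xi : x ^+ (m * i) != 0 by rewrite expf_neq0.
apply: (mulfI xi); transitivity (y ^+ i * (iota (c i) *
   (eval1 iota x P`_d * (x ^+ (m * d) * x ^+ (n * i))))); first by field.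
by rewrite -E; ring.
Qed.
End AlgebraicLogDeriv.

(** * Degrees of relations between powers *)

Lemma fractionP (R : idomainType) (z : {fraction R}) :
  exists n d : R, d != 0 /\ z * FracField.tofrac d = FracField.tofrac n.
Proof.
elim/quotW: z => u; exists (frac u).1, (frac u).2; split; first exact: denom_ratioP.
have u0 := denom_ratioP u.
unlock FracField.tofrac; rewrite -[LHS]FracField.pi_mul /FracField.mulf.
apply/eqmodP; rewrite /= FracField.equivfE.
by rewrite !numden_Ratio ?oner_eq0 ?mulf_neq0 ?oner_eq0 // !mulr1 mulrC.
Qed.

(** Over the fraction field a matrix with more rows than columns has a nonzero left kernel; the
    product of the denominators brings a kernel vector back to [R]. *)
Lemma linear_dependence (R : idomainType) (I J : finType) (M : I -> J -> R) :
  (#|J| < #|I|)%N ->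
  exists lam : I -> R, (exists i, lam i != 0) /\ forall j, \sum_i lam i * M i j = 0.
Proof.
move=> ltJI; pose F := {fraction R}; pose f := @FracField.tofrac R.
pose A : 'M[F]_(#|I|, #|J|) := \matrix_(i, j) f (M (enum_val i) (enum_val j)).
have kn0 : kermx A != 0.
  rewrite -mxrank_eq0 mxrank_ker subn_eq0 -ltnNge.
  exact: leq_ltn_trans (rank_leq_col _) ltJI.
have /rowV0Pn[v vA v0] := kn0.
have {vA} vA : v *m A = 0 by apply/sub_kermxP.
have [D [w [D0 hw]]] : exists D (w : I -> R),
    D != 0 /\ forall i, f (w i) = f D * v 0 (enum_rank i).
  have /boolp.choice[num /boolp.choice[den hnd]] := fun i => fractionP (v 0 (enum_rank i)).
  have den0 i : den i != 0 by case: (hnd i).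
  have vE i : v 0 (enum_rank i) * FracField.tofrac (den i) =
      FracField.tofrac (num i) by case: (hnd i).
  exists (\prod_i den i), (fun i => num i * \prod_(j | j != i) den j); split.
    by apply/prodf_neq0 => i _.
  move=> i; rewrite [\prod_i den i](bigD1 i) //= /f !tofracM -vE /f; ring.
exists w; split.
  have /rV0Pn[i vi0] := v0.
  exists (enum_val i); rewrite -(tofrac_eq0) -/(f _) hw enum_valK mulf_neq0 //.
  by rewrite tofrac_eq0.
move=> j; apply/eqP; rewrite -tofrac_eq0 rmorph_sum.
suff -> : \sum_i FracField.tofrac (w i * M i j) = f D * (v *m A) 0 (enum_rank j).
  by rewrite vA mxE mulr0.
rewrite mxE mulr_sumr [RHS](reindex_onto enum_rank enum_val) /=; last first.
  by move=> i _; exact: enum_valK.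
apply: eq_big => [i|i _]; first by rewrite enum_rankK eqxx.
by rewrite tofracM -/(f _) hw !mxE !enum_rankK mulrA.
Qed.

Section CountRelations.
Variables (R : idomainType) (K : fieldType) (g : {rmorphism R -> K}).

Lemma eval1_comp_Xn x n (p : {poly R}) :
  eval1 g x (p \Po 'X^n) = eval1 g (x ^+ n) p.
Proof. by rewrite /eval1 map_comp_poly map_polyXn horner_comp hornerXn. Qed.

Lemma transcendental_exp x n :
  (0 < n)%N -> transcendental g x -> transcendental g (x ^+ n).
Proof.
move=> n0 tx p; rewrite -eval1_comp_Xn => /tx e; apply/polyP => i.
have := congr1 (fun q : {poly R} => q`_(i * n)) e.
by rewrite coef_comp_poly_Xn // dvdn_mull // mulnK // !coef0.
Qed.

Lemma eval1_split x n (p : {poly R}) : (0 < n)%N ->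
  exists c : 'I_n -> {poly R},
    eval1 g x p = \sum_(i < n) eval1 g (x ^+ n) (c i) * x ^+ i.
Proof.
case: n => // n _; elim/poly_ind: p => [|p a [c IH]].
  by exists (fun=> 0); rewrite rmorph0 big1 // => i _; rewrite rmorph0 mul0r.
(* Multiplication by [x] shifts the coefficients; the last one wraps around to index 0 with a factor
   [x ^+ n]. *)
exists (fun i => if unlift ord0 i is Some j then c (widen_ord (leqnSn n) j)
                 else c ord_max * 'X + a%:P).
rewrite big_ord_recl unlift_none !eval1D !eval1M !eval1X !eval1C IH big_ord_recr /=.
rewrite mulrDl expr0 mulr1 -!addrA.
rewrite mulr_suml addrC -addrA; congr (_ + _); first by rewrite exprSr; ring.
congr (_ + _); apply: eq_bigr => i _.
by rewrite liftK /bump /= add1n -mulrA -exprSr.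
Qed.

(* [w] has degree at most [(size F).-1] over [R(x)], itself of degree [n] over *)
(* [R(x^n)]: the first powers of [w] are linearly dependent over [R[x^n]].    *)
Lemma relation_exp x w (F : {poly {poly R}}) n :
  transcendental g x -> F != 0 -> eval2 g x w F = 0 -> (0 < n)%N ->
  exists2 G : {poly {poly R}}, G != 0 &
    eval2 g (x ^+ n) w G = 0 /\ (size G <= ((size F).-1 * n).+1)%N.
Proof.
move=> tx F0 eF n0; set b := (size F).-1.
have sF : size F = b.+1 by rewrite /b prednK // size_poly_gt0.
pose I : finType := 'I_(b * n).+1.
have [S [t ht]] := pseudo_division (fun k : I => 'X^k) F0 eF.
have lead0 : eval1 g x (lead_coef F) ^+ S != 0.
  by rewrite expf_neq0 //; apply/eqP => /tx/eqP; rewrite lead_coef_eq0 (negPf F0).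
have /boolp.choice[c hc] := fun kj : I * 'I_b => eval1_split x (t kj.1)`_kj.2 n0.
(* There are [b * n + 1] powers of [w] for only [b * n] products [x ^+ i * w ^+ j]. *)
have [|lam [[k0 lam0] hlam]] :=
  @linear_dependence _ I ('I_b * 'I_n)%type (fun k ji => c (k, ji.1) ji.2).
  by rewrite card_prod !card_ord.
pose G := \poly_(k < (b * n).+1) lam (inord k).
exists G.
  apply: contra_neq lam0 => /(congr1 (fun H : {poly {poly R}} => H`_k0)).
  by rewrite coef_poly ltn_ord inord_val coef0.
split; last exact: size_poly.
apply: (mulfI lead0); rewrite mulr0 (eval2_wide _ _ _ (size_poly _ _)) mulr_sumr.
transitivity (\sum_(k : I) \sum_(ji : 'I_b * 'I_n)
    eval1 g (x ^+ n) (lam k * c (k, ji.1) ji.2) * (x ^+ ji.2 * w ^+ ji.1)).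
  apply: eq_bigr => k _; rewrite coef_poly ltn_ord inord_val.
  have [szt et] := ht k; rewrite sF ltnS in szt.
  have wk : w ^+ k = eval2 g x w 'X^k by rewrite eval2Xn eval2X.
  rewrite mulrCA wk et (eval2_wide _ _ _ szt) mulr_sumr.
  transitivity (\sum_(j < b) \sum_(i < n)
     eval1 g (x ^+ n) (lam k * c (k, j) i) * (x ^+ i * w ^+ j)); last first.
    by rewrite pair_bigA.
  apply: eq_bigr => j _; rewrite (hc (k, j)) mulr_suml mulr_sumr.
  by apply: eq_bigr => i _; rewrite eval1M; ring.
rewrite exchange_big big1 //= => ji _; rewrite -mulr_suml -rmorph_sum /= hlam.
by rewrite rmorph0 mul0r.
Qed.

(* Conversely the [n] powers [x^i], [i < n], are independent over [R(x^n)]    *)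
(* and lie in a space spanned by the products [x^i w^j] with                  *)
(* [i < (size F).-1] and [j < (size G).-1].                                   *)
Lemma relation_exp_lower x w (F G : {poly {poly R}}) n :
  transcendental g x -> transcendental g w -> F != 0 -> eval2 g w x F = 0 ->
  (0 < n)%N -> G != 0 -> eval2 g (x ^+ n) w G = 0 ->
  (n <= (size F).-1 * (size G).-1)%N.
Proof.
move=> tx tw F0 eF n0 G0 eG; rewrite leqNgt; apply/negP => lt.
set a := (size F).-1 in lt; set b := (size G).-1 in lt.
have sF : size F = a.+1 by rewrite /a prednK // size_poly_gt0.
have sG : size G = b.+1 by rewrite /b prednK // size_poly_gt0.
have txn := transcendental_exp n0 tx.
have [S [t ht]] := pseudo_division (fun k : 'I_n => 'X^k) F0 eF.
(* [F] has lowered the degree in [x]; now [G] lowers the degree in [w] of the coefficients, which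
   [map_poly polyC] turns into polynomials in [w] over [R[x^n]]. *)
have [T [u hu]] := pseudo_division
  (fun ki : 'I_n * 'I_a => map_poly polyC (t ki.1)`_ki.2) G0 eG.
have leadF : eval1 g w (lead_coef F) ^+ S != 0.
  by rewrite expf_neq0 //; apply/eqP => /tw/eqP; rewrite lead_coef_eq0 (negPf F0).
have leadG : eval1 g (x ^+ n) (lead_coef G) ^+ T != 0.
  by rewrite expf_neq0 //; apply/eqP => /txn/eqP; rewrite lead_coef_eq0 (negPf G0).
have [|lam [[k0 lam0] hlam]] :=
  @linear_dependence _ 'I_n ('I_a * 'I_b)%type (fun k ij => (u (k, ij.1))`_ij.2).
  by rewrite card_prod !card_ord.
pose p := \sum_(k < n) (lam k \Po 'X^n) * 'X^k.
have p0 : p = 0.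
  apply: tx; apply: (mulfI (mulf_neq0 leadF leadG)).
  rewrite mulr0 rmorph_sum mulr_sumr.
  transitivity (\sum_(k < n) \sum_(ij : 'I_a * 'I_b)
    eval1 g (x ^+ n) (lam k * (u (k, ij.1))`_ij.2) * (x ^+ ij.1 * w ^+ ij.2)).
    apply: eq_bigr => k _; rewrite /= eval1M eval1_comp_Xn eval1Xn eval1X.
    have [szt et] := ht k; rewrite sF ltnS in szt.
    have xk : x ^+ k = eval2 g w x 'X^k by rewrite eval2Xn eval2X.
    transitivity (eval2 g w x (t k) *
        (eval1 g (x ^+ n) (lead_coef G) ^+ T * eval1 g (x ^+ n) (lam k))).
      by rewrite -et xk; ring.
    rewrite (eval2_wide _ _ _ szt) mulr_suml.
    transitivity (\sum_(i < a) \sum_(j < b)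
       eval1 g (x ^+ n) (lam k * (u (k, i))`_j) * (x ^+ i * w ^+ j)); last first.
      by rewrite pair_bigA.
    apply: eq_bigr => i _.
    have [szu eu] := hu (k, i); rewrite sG ltnS in szu.
    rewrite eval2_mapC in eu.
    transitivity (eval1 g (x ^+ n) (lam k) * x ^+ i * eval2 g (x ^+ n) w (u (k, i))).
      by rewrite -eu /=; ring.
    rewrite (eval2_wide _ _ _ szu) mulr_sumr; apply: eq_bigr => j _.
    by rewrite eval1M; ring.
  rewrite exchange_big big1 //= => ij _; rewrite -mulr_suml -rmorph_sum /= hlam.
  by rewrite rmorph0 mul0r.
apply/negP: lam0; rewrite negbK; apply/eqP/polyP => l; rewrite coef0.
(* Indices [k < n] are distinct modulo [n], so the coefficients of the various [lam k] do not mix in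
   [p]. *)
have := congr1 (fun q : {poly R} => q`_(l * n + k0)) p0.
rewrite coef0 coef_sum (bigD1 k0) //= coefMXn ltnNge leq_addl /= addnK.
rewrite coef_comp_poly_Xn // dvdn_mull // mulnK // big1 ?addr0 // => k kk0.
rewrite coefMXn; case: ifP => // le; rewrite coef_comp_poly_Xn //.
case: ifP => // dv; case/negP: kk0; rewrite -val_eqE /=.
have : (l * n + k0 = k %[mod n])%N.
  apply/eqP; rewrite eqn_mod_dvd // leqNgt; by rewrite le.
by rewrite modnMDl !modn_small // => ->.
Qed.

End CountRelations.

(** If [n < c], Bernoulli's inequality bounds [c ^ m / n ^ m] below by [1 + m / n], which exceeds
    [C] at [m = n * C]. *)
Lemma expn_growth C n c :
  (0 < n)%N -> (forall m, c ^ m <= C * n ^ m)%N -> (c <= n)%N.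
Proof.
move=> n0 H; rewrite leqNgt; apply/negP => lt.
have bern m : (n ^ m * (n + m) <= n * n.+1 ^ m)%N.
  elim: m => [|m IH]; first by rewrite addn0 !expn0 mul1n muln1.
  rewrite !expnSr [X in (_ <= X)%N]mulnA; apply: leq_trans (leq_mul IH (leqnn n.+1)).
  by rewrite -!mulnA leq_mul2l; apply/orP; right; nia.
have {}bern m : (n ^ m * (n + m) <= n * c ^ m)%N.
  apply: leq_trans (bern m) _; rewrite leq_mul2l; apply/orP; right.
  by case: m => // m; rewrite leq_exp2r.
have := leq_trans (bern (n * C)%N) (leq_mul (leqnn n) (H _)).
have : (0 < n ^ (n * C))%N by rewrite expn_gt0 n0.
by move: (n ^ (n * C))%N => e; nia.
Qed.

Lemma eval2_swap (R K : comNzRingType) (g : {rmorphism R -> K}) x y F :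
  eval2 g x y (swapXY F) = eval2 g y x F.
Proof.
elim/poly_ind: F => [|F p IH]; first by rewrite !rmorph0.
rewrite rmorphD rmorphM /= swapXY_X swapXY_polyC !eval2D !eval2M IH.
by rewrite eval2X !eval2C eval1X eval2_mapC.
Qed.

(** * Clearing denominators in relations *)

Section Homogenization.
Variables (R : comNzRingType) (F : fieldType).

Definition homogenize (G : {poly {poly R}}) (A B : {poly {poly R}}) :=
  \sum_(i < size G) (G`_i)%:P * (A ^+ i * B ^+ ((size G).-1 - i)).

Lemma eval2_homogenize (g : {rmorphism R -> F}) x y G A B :
  eval2 g x y B != 0 ->
  eval2 g x y (homogenize G A B) =
  eval2 g x y B ^+ (size G).-1 * eval2 g x (eval2 g x y A / eval2 g x y B) G.
Proof.
move=> B0; rewrite rmorph_sum [eval2 g x (_ / _) G](eval2_wide _ _ _ (leqnn _)) mulr_sumr.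
apply: eq_bigr => i _; rewrite /= !eval2M eval2C !eval2Xn expr_div_n.
have -> : eval2 g x y B ^+ (size G).-1 =
  eval2 g x y B ^+ i * eval2 g x y B ^+ ((size G).-1 - i).
  by rewrite -exprD subnKC // -ltnS prednK // (leq_ltn_trans _ (ltn_ord i)).
have Bi : eval2 g x y B ^+ i != 0 by rewrite expf_neq0.
by field.
Qed.

(** The numerator of [G(x, (a / b) w)]: a rational scaling of the second variable with coefficients
    kept in [R]. *)
Definition rescale (a b : nat) (G : {poly {poly R}}) : {poly {poly R}} :=
  \poly_(i < size G) ((a ^ i * b ^ ((size G).-1 - i))%:R * G`_i).

Lemma eval2_rescale (g : {rmorphism R -> F}) x w a b G : b%:R != 0 :> F ->
  eval2 g x w (rescale a b G) = b%:R ^+ (size G).-1 * eval2 g x (a%:R / b%:R * w) G.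
Proof.
move=> b0; rewrite (eval2_wide _ _ _ (size_poly _ _)).
rewrite [eval2 g x (_ * _) G](eval2_wide _ _ _ (leqnn _)) mulr_sumr.
apply: eq_bigr => i _; rewrite coef_poly ltn_ord eval1M rmorph_nat natrM !natrX.
have -> : b%:R ^+ (size G).-1 = b%:R ^+ i * b%:R ^+ ((size G).-1 - i) :> F.
  by rewrite -exprD subnKC // -ltnS prednK // (leq_ltn_trans _ (ltn_ord i)).
have bi : b%:R ^+ i != 0 :> F by rewrite expf_neq0.
by rewrite exprMn expr_div_n; field.
Qed.

End Homogenization.

Lemma rescale_neq0 (a b : nat) (G : {poly {poly int}}) :
  (0 < a)%N -> (0 < b)%N -> G != 0 -> rescale a b G != 0.
Proof.
move=> a0 b0 G0; apply/eqP => /(congr1 (fun H : {poly {poly int}} => H`_(size G).-1)).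
rewrite coef_poly prednK ?size_poly_gt0 // leqnn subnn muln1 coef0 -lead_coefE.
move/eqP; rewrite mulf_eq0 lead_coef_eq0 (negPf G0) orbF.
by rewrite -polyC_natr polyC_eq0 pnatr_eq0 expn_eq0 eqn0Ngt a0.
Qed.

Lemma map_map_poly_neq0 (R S : nzRingType) (f : {rmorphism R -> S}) (G : {poly {poly R}}) :
  injective f -> G != 0 -> map_poly (map_poly f) G != 0.
Proof.
move=> injf; apply: contra_neq => e; apply/polyP => i; apply/polyP => j.
have := congr1 (fun H : {poly {poly S}} => H`_i`_j) e.
by rewrite !coef_map !coef0 => e'; apply: injf; rewrite e' rmorph0.
Qed.

Lemma eval2_intr_comp (K : comNzRingType) (u v : K) (X Y : {poly {poly int}}) G :
  eval2 intr u v (eval2 intr X Y G) =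
  eval2 intr (eval2 intr u v X) (eval2 intr u v Y) G.
Proof.
exact: (@eval2_morph _ _ _ intr (eval2 intr u v) intr X Y G (rmorph_int _)).
Qed.

(** * Comparison of the exponents *)

Section Homothety.
Variable A : idomainType.
Hypothesis charA : [pchar A] =i pred0.
Hypothesis dependent : forall a b : A,
  exists2 G : {poly {poly int}}, G != 0 & eval2 intr a b G = 0.

Variables (K : fieldType) (j : {rmorphism A -> K}).
Hypothesis j_inj : injective j.

Variables x y : A.
Hypothesis x_transc : ~ alg_over (intr : int -> K) (j x).
Hypothesis xy_transc : forall d m n, (0 < d)%N ->
  ~ alg_over (intr : int -> K) (j y ^+ d * j x ^+ n / j x ^+ m).

Let j_eq0 a : (j a == 0) = (a == 0).
Proof. by rewrite -(inj_eq j_inj) rmorph0. Qed.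

Let charK : [pchar K] =i pred0.
Proof.
apply/pcharf0P => n; rewrite -(rmorph_nat j) j_eq0.
exact: ((pcharf0P _).1 charA).
Qed.

Let intrK_inj : injective (intr : int -> K).
Proof.
move=> m n /eqP; rewrite -subr_eq0 -intrB intr_char0_eq0 //.
by rewrite subr_eq0 => /eqP.
Qed.

Let evalj a b G : j (eval2 intr a b G) = eval2 intr (j a) (j b) G.
Proof. by apply: eval2_morph => c; rewrite rmorph_int. Qed.

Let evalj_eq0 a b G : (eval2 intr (j a) (j b) G == 0) = (eval2 intr a b G == 0).
Proof. by rewrite -evalj j_eq0. Qed.

Let alg0 : alg_over (intr : int -> K) 0.
Proof. by rewrite -(rmorph0 intr); exact: alg_id. Qed.

Let x0 : j x != 0.
Proof. by apply/eqP => e; apply: x_transc; rewrite e. Qed.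

Let y0 : j y != 0.
Proof.
apply/eqP => e; have := @xy_transc 1 0 0 isT.
by rewrite e expr1 !mul0r => /(_ alg0).
Qed.

Let eval1_map (R : comNzRingType) (g : {rmorphism int -> R}) (h : {rmorphism R -> K}) z p :
  eval1 h z (map_poly g p) = eval1 (intr : int -> K) z p.
Proof.
rewrite /eval1 -map_poly_comp; congr (_.[_]).
by apply: eq_map_poly => c /=; rewrite -[c in LHS]intz !rmorph_int.
Qed.

Let transc_int z : ~ alg_over (intr : int -> K) z -> transcendental (intr : int -> K) z.
Proof.
move=> nalg p pz; apply/eqP/negPn/negP => p0; apply: nalg; exists p; last exact/rootP.
apply: contra_neq p0 => e; apply: (map_inj_poly intrK_inj); rewrite ?rmorph0 //.
Qed.

(** Encodes, by equality of the ideals of relations, an isomorphism of [Z[x^n1, y^n2]] with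
    [Z[x^c1, y^c2]] matching the generators. *)
Definition homothetic n1 n2 c1 c2 := forall G : {poly {poly int}},
  eval2 intr (x ^+ n1) (y ^+ n2) G = 0 <-> eval2 intr (x ^+ c1) (y ^+ c2) G = 0.

Lemma homothetic_mul a b n1 n2 c1 c2 : homothetic n1 n2 c1 c2 ->
  homothetic (n1 * a) (n2 * b) (c1 * a) (c2 * b).
Proof.
move=> E G; have sub u v : eval2 intr (u ^+ a) (v ^+ b) G =
    eval2 intr u v (eval2 (intr : int -> {poly {poly int}}) ('X^a)%:P 'X^b G) :> A.
  by rewrite eval2_intr_comp eval2C eval1Xn eval1X eval2Xn eval2X.
by rewrite !exprM !sub; exact: E.
Qed.

(** Two steps: [E] scaled by [n ^ m] leads from [n * n ^ m] to [c1 * n ^ m] and [c2 * n ^ m]; the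
    induction hypothesis scaled by [c1] and [c2] finishes. *)
Lemma homothetic_pow n c1 c2 : homothetic n n c1 c2 -> forall m,
  homothetic (n ^ m) (n ^ m) (c1 ^ m) (c2 ^ m).
Proof.
move=> E; elim=> [|m IH] G; first exact: iff_refl.
rewrite !expnS; apply: (iff_trans (homothetic_mul (n ^ m) (n ^ m) E G)).
by rewrite ![(c1 * _)%N]mulnC ![(c2 * _)%N]mulnC; exact: homothetic_mul IH G.
Qed.

(** If [H] vanished only at the second pair, its value [a] at the first would satisfy a relation [P]
    over [Z[x^n]] with nonzero constant coefficient. Transferring [P] makes that coefficient vanish
    at [x ^+ c1], although [x] is transcendental. *)
Lemma homothetic_of_imp n c1 c2 : (0 < n)%N -> (0 < c1)%N ->
  (forall G : {poly {poly int}}, eval2 intr (x ^+ n) (y ^+ n) G = 0 ->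
     eval2 intr (x ^+ c1) (y ^+ c2) G = 0) ->
  homothetic n n c1 c2.
Proof.
move=> n0 c10 imp H; split=> [|eH]; first exact: imp.
apply/eqP/negPn/negP; set a := eval2 _ _ _ _ => a0.
have [G G0 eG] := dependent (x ^+ n) a.
have [P minP] := exists_minimal_relation G0 eG.
have [P0 eP _] := minP.
have sub u v : eval2 intr u (eval2 intr u v H) P =
    eval2 intr u v (eval2 (intr : int -> {poly {poly int}}) 'X%:P H P) :> A.
  by rewrite eval2_intr_comp eval2C eval1X.
have := eP; rewrite /a sub => /imp; rewrite -sub eH => e.
have : eval1 intr (x ^+ c1) P`_0 = 0.
  by rewrite -eval2_at0.
move/(congr1 j); rewrite (eval1_morph (h := j) (g' := intr)); last first.
  by move=> c; rewrite rmorph_int.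
rewrite rmorph0 rmorphXn /= => /(transcendental_exp c10 (transc_int x_transc))/eqP.
by rewrite (negPf (minimal_coef0 a0 minP)).
Qed.

Local Notation k := (rel_alg_field K).
Local Notation iota := (@rel_alg_val K).

Let chark : [pchar k] =i pred0.
Proof. by move=> p; rewrite -(fmorph_pchar iota) charK. Qed.

Let intrk_inj : injective (intr : int -> k).
Proof. by move=> m n /(congr1 iota); rewrite !rmorph_int => /intrK_inj. Qed.

Let transc_k z : ~ alg_over (intr : int -> K) z -> transcendental iota z.
Proof.
move=> nalg p pz; apply/eqP/negPn/negP => p0; apply: nalg.
by apply: (rel_alg_trans p0); apply/rootP.
Qed.

Let eval2_map (G : {poly {poly int}}) u v :
  eval2 iota u v (map_poly (map_poly (intr : int -> k)) G) = eval2 intr u v G.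
Proof.
rewrite /eval2 {1}/eval1 -map_poly_comp /eval1; congr (_.[_]).
by apply: eq_map_poly => p /=; exact: eval1_map.
Qed.

Let exists_minimal_k b : exists P, minimal_relation iota (j x) (j b) P.
Proof.
have [G G0 eG] := dependent x b.
apply: (@exists_minimal_relation _ _ _ _ _ (map_poly (map_poly (intr : int -> k)) G)).
  exact: map_map_poly_neq0 intrk_inj G0.
by rewrite eval2_map; apply/eqP; rewrite evalj_eq0; apply/eqP.
Qed.

(** An algebraic [r] would be a rational [(m - n) / d]. Then [y ^+ d] has logarithmic derivative
    [m - n], and [log_deriv_integer] contradicts [xy_transc]. *)
Lemma exists_transcendental_log_deriv :
  exists2 r, log_deriv iota (j x) (j y) r & ~ alg_over (intr : int -> K) r.
Proof.
have tx := transc_k x_transc.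
have [P minP] := exists_minimal_k y.
have [r der] := exists_log_deriv chark y0 tx minP.
exists r; first exact: der.
move=> /rel_alg_exists[rho er]; rewrite -er in der.
have [d [m [n [d0 e]]]] := log_deriv_rational y0 tx minP der.
have [P' minP'] := exists_minimal_k (y ^+ d).
have der' : log_deriv iota (j x) (j (y ^+ d)) (m%:R - n%:R).
  move=> G; rewrite rmorphXn /=.
  rewrite -{1}[j x]expr1 => eG.
  have := @log_deriv_exp _ _ _ iota idfun iota _ _ _ 1 d G (fun=> erefl) der eG.
  rewrite !expr1 mul1r -(rmorph_nat iota) -rmorphM mulrC.
  by rewrite -(rmorph_nat iota m) -(rmorph_nat iota n) -rmorphB -e /= [d%:R * rho]mulrC.
have yd0 : j (y ^+ d) != 0 by rewrite rmorphXn expf_neq0.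
have [p p0 rp] := log_deriv_integer chark x0 tx minP' der'.
apply: (@xy_transc d m n d0); apply: (rel_alg_trans (p := p)).
  by apply: contraNneq p0 => ->; rewrite rmorph0.
by rewrite -rmorphXn.
Qed.

Let charint : [pchar int] =i pred0.
Proof. by apply/pcharf0P => n; rewrite pnatr_eq0. Qed.

Let evaljX a b m n G :
  j (eval2 intr (a ^+ m) (b ^+ n) G) = eval2 intr (j a ^+ m) (j b ^+ n) G.
Proof. by rewrite evalj !rmorphXn. Qed.

Let transcA n : (0 < n)%N -> transcendental (intr : int -> A) (x ^+ n).
Proof.
move=> n0 p /(congr1 j); rewrite (eval1_morph (h := j) (g' := intr)); last first.
  by move=> c; rewrite rmorph_int.
by rewrite rmorph0 rmorphXn /= => /(transcendental_exp n0 (transc_int x_transc)).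
Qed.

Lemma homothetic_transfer r n c1 c2 : log_deriv iota (j x) (j y) r ->
  (0 < n)%N -> (0 < c1)%N -> (0 < c2)%N -> homothetic n n c1 c2 ->
  (exists u v, r = j u / j v) /\
  forall G : {poly {poly int}}, eval2 intr (j x ^+ n) r G = 0 <->
    eval2 intr (j x ^+ c1) (c2%:R / c1%:R * r) G = 0.
Proof.
move=> der n0 c10 c20 E.
have natK m : (0 < m)%N -> m%:R != 0 :> K.
  by move=> m0; rewrite ((pcharf0P _).1 charK) -lt0n.
have [G0 G00 eG0] := dependent (x ^+ n) (y ^+ n).
have [F minF] := exists_minimal_relation G00 eG0.
have [F0 eF _] := minF.
have dF := minimal_deriv_neq0 charint (transcA n0) minF.
have eF' := (E F).1 eF.
(* Differentiating [F] gives [r = U / V] at the first pair and [(c2 / c1) r = U / V] at the second,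
   so relations involving [r] transfer as relations between powers of [x] and [y]. *)
pose U : {poly {poly int}} := - ('X%:P * derivU F).
pose V : {poly {poly int}} := 'X * F^`().
have UV a b p q : p%:R != 0 :> K ->
    p%:R * j x ^+ a * eval2 intr (j x ^+ a) (j y ^+ b) (derivU F) +
    q%:R * r * j y ^+ b * eval2 intr (j x ^+ a) (j y ^+ b) F^`() = 0 ->
    eval2 intr (j x ^+ a) (j y ^+ b) U =
    q%:R / p%:R * r * eval2 intr (j x ^+ a) (j y ^+ b) V.
  move=> p0 e.
  have -> : eval2 intr (j x ^+ a) (j y ^+ b) U =
      - (j x ^+ a * eval2 intr (j x ^+ a) (j y ^+ b) (derivU F)).
    by rewrite eval2N eval2M eval2C eval1X.
  rewrite eval2M eval2X; apply: (mulfI p0).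
  move: (eval2 _ _ _ (derivU F)) (eval2 _ _ _ F^`()) e => du dv e.
  by apply/eqP; rewrite -subr_eq0 -oppr_eq0 -[X in _ == X]e; apply/eqP; field.
have int_k (c : int) : iota c%:~R = c%:~R by rewrite rmorph_int.
have eFn : eval2 intr (j x ^+ n) (j y ^+ n) F = 0 by rewrite -evaljX eF rmorph0.
have eFc : eval2 intr (j x ^+ c1) (j y ^+ c2) F = 0 by rewrite -evaljX eF' rmorph0.
have := UV n n n n (natK n n0) (log_deriv_exp int_k der eFn).
have nn : n%:R / n%:R = 1 :> K by exact: divff (natK n n0).
rewrite nn mul1r => eUn.
have eUc := UV c1 c2 c1 c2 (natK c1 c10) (log_deriv_exp int_k der eFc).
have Vn : eval2 intr (x ^+ n) (y ^+ n) V != 0.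
  rewrite eval2M eval2X; apply: mulf_neq0; last exact: dF.
  by rewrite -j_eq0 rmorphXn expf_neq0.
(* [F] need not be minimal at the second pair; the nonvanishing of [V] there comes from the converse
   half of [E]. *)
have Vc : eval2 intr (x ^+ c1) (y ^+ c2) V != 0.
  by apply: contra_neq Vn => /(E V).2.
rewrite -j_eq0 evaljX in Vn; rewrite -j_eq0 evaljX in Vc.
have rn : eval2 intr (j x ^+ n) (j y ^+ n) U / eval2 intr (j x ^+ n) (j y ^+ n) V = r.
  by rewrite eUn mulfK.
have rc : eval2 intr (j x ^+ c1) (j y ^+ c2) U / eval2 intr (j x ^+ c1) (j y ^+ c2) V
    = c2%:R / c1%:R * r.
  by rewrite eUc mulfK.
split=> [|G].
  exists (eval2 intr (x ^+ n) (y ^+ n) U), (eval2 intr (x ^+ n) (y ^+ n) V).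
  by rewrite !evaljX.
have hn := eval2_homogenize G U Vn; rewrite rn in hn.
have hc := eval2_homogenize G U Vc; rewrite rc in hc.
have tn : eval2 intr (j x ^+ n) r G = 0 <->
    eval2 intr (x ^+ n) (y ^+ n) (homogenize G U V) = 0.
  split=> [e|e]; first by apply/eqP; rewrite -j_eq0 evaljX hn e mulr0.
  move: hn; rewrite -evaljX e rmorph0 => /esym/eqP.
  by rewrite mulf_eq0 expf_eq0 (negPf Vn) andbF => /eqP.
have tc : eval2 intr (j x ^+ c1) (c2%:R / c1%:R * r) G = 0 <->
    eval2 intr (x ^+ c1) (y ^+ c2) (homogenize G U V) = 0.
  split=> [e|e]; first by apply/eqP; rewrite -j_eq0 evaljX hc e mulr0.
  move: hc; rewrite -evaljX e rmorph0 => /esym/eqP.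
  by rewrite mulf_eq0 expf_eq0 (negPf Vc) andbF => /eqP.
by rewrite tn tc; exact: E.
Qed.

Lemma homothetic_exponent n c1 c2 : (0 < n)%N -> (0 < c1)%N -> (0 < c2)%N ->
  (forall G : {poly {poly int}}, eval2 intr (x ^+ n) (y ^+ n) G = 0 ->
     eval2 intr (x ^+ c1) (y ^+ c2) G = 0) ->
  c1 = n.
Proof.
move=> n0 c10 c20 imp.
have E := homothetic_of_imp n0 c10 imp.
have [r der r_transc] := exists_transcendental_log_deriv.
have pos a m : (0 < a)%N -> (0 < a ^ m)%N by rewrite expn_gt0 => ->.
have trans m := homothetic_transfer der (pos n m n0) (pos c1 m c10) (pos c2 m c20)
   (homothetic_pow E m).
(* Any [m] shows that [r] is a quotient of elements of [A], hence algebraic over [Q(x)]. *)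
have [[u [v er]] _] := trans 0%N.
have tX := transc_int x_transc; have tr := transc_int r_transc.
have natK m : (0 < m)%N -> m%:R != 0 :> K.
  by move=> m0; rewrite ((pcharf0P _).1 charK) -lt0n.
have alg_j a : alg_over (eval1 (intr : int -> K) (j x)) (j a).
  have [G G0 eG] := dependent x a; exists G; last first.
    by apply/rootP; apply/eqP; rewrite -/(eval2 intr (j x) (j a) G) evalj_eq0 eG.
  apply: contra_neq G0 => e; apply/polyP => i; rewrite coef0; apply: tX.
  have := congr1 (fun H : {poly K} => H`_i) e; by rewrite coef_map coef0.
have [F Fn0 rF] : alg_over (eval1 (intr : int -> K) (j x)) r.
  by rewrite er; apply: alg_mul; [exact: alg_j|apply: alg_inv; exact: alg_j].
have F0 : F != 0 by apply: contraNneq Fn0 => ->; rewrite rmorph0.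
have eF : eval2 intr (j x) r F = 0 by apply/rootP.
have sF0 : swapXY F != 0 by rewrite swapXY_eq0.
have esF : eval2 intr r (j x) (swapXY F) = 0 by rewrite eval2_swap.
set al := (size (swapXY F)).-1; set be := (size F).-1.
(* [rescale] absorbs the factor [a / b], after which [relation_exp_lower] bounds [M]. Both
   inequalities between [c1] and [n] follow from it by [expn_growth]. *)
have bound (N M a b : nat) (G : {poly {poly int}}) :
    (0 < a)%N -> (0 < b)%N -> (0 < M)%N -> G != 0 ->
    (size G <= (be * N).+1)%N -> eval2 intr (j x ^+ M) (a%:R / b%:R * r) G = 0 ->
    (M <= al * be * N)%N.
  move=> a0 b0 M0 G0 szG eG.
  have := relation_exp_lower tX tr sF0 esF M0 (rescale_neq0 a0 b0 G0).
  rewrite eval2_rescale ?natK // eG mulr0 => /(_ erefl) le.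
  rewrite -mulnA (leq_trans le) // leq_mul // -ltnS prednK.
    by rewrite (leq_trans (size_poly _ _)).
  by rewrite size_poly_gt0 rescale_neq0.
apply/eqP; rewrite eqn_leq; apply/andP; split; apply: (@expn_growth (al * be)) => // m.
  have [G G0 [eG szG]] := relation_exp tX F0 eF (pos n m n0).
  exact: bound (pos c2 m c20) (pos c1 m c10) (pos c1 m c10) G0 szG (((trans m).2 G).1 eG).
have [G G0 [eG szG]] := relation_exp tX F0 eF (pos c1 m c10).
(* The rescaling cancels the factor [c2 ^ m / c1 ^ m] that the transfer introduces. *)
pose H := rescale (c1 ^ m) (c2 ^ m) G.
have H0 : H != 0 by rewrite rescale_neq0 ?pos.
have szH : (size H <= (be * c1 ^ m).+1)%N by rewrite (leq_trans (size_poly _ _)).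
have eH : eval2 intr (j x ^+ (n ^ m)) r H = 0.
  apply: ((trans m).2 H).2; rewrite eval2_rescale ?natK ?pos //.
  rewrite mulrA mulf_div [X in X / _]mulrC divff ?mulf_neq0 ?natK ?pos //.
  by rewrite mul1r eG mulr0.
apply: (bound _ _ 1%N 1%N H) => //; first exact: pos.
by rewrite divr1 mul1r.
Qed.

End Homothety.

(** * Group rings *)

Section FreeBasis.
Variables (Q : zmodType) (s : nat) (x : 'I_s -> Q).

(** Expressing the standard basis in the generators gives a left inverse of the square matrix [X],
    hence a two-sided one. *)
Lemma generates_independent (m : 'I_s -> int) :
  free_abelian_of_rank Q s -> generates x ->
  \sum_(i < s) x i *~ m i = 0 -> forall i, m i = 0.
Proof.
move=> [f [finv fK finvK]] gen sum0.
pose X := \matrix_(i < s) f (x i).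
have fsum (v : 'I_s -> int) :
    f (\sum_(i < s) x i *~ v i) = \row_(i < s) v i *m X.
  rewrite raddf_sum mulmx_sum_row; apply: eq_bigr => i _.
  by rewrite raddfMz mxE rowK -scaler_int intz.
have /boolp.choice[M hM] : forall k : 'I_s, exists v : 'I_s -> int,
    finv (delta_mx 0 k) = \sum_(i < s) x i *~ v i.
  by move=> k; exact/asboolP/gen.
have MX : (\matrix_(k < s, i < s) M k i) *m X = 1%:M.
  apply/row_matrixP => k; rewrite row_mul row1 -[RHS]finvK hM fsum.
  by congr (_ *m _); apply/rowP => i; rewrite !mxE.
have v0 : \row_(i < s) m i = 0.
  rewrite -[LHS]mulmx1 -(mulmx1C MX) mulmxA -fsum sum0.
  by rewrite raddf0 mul0mx.
by move=> i; have := congr1 (fun v : 'rV[int]_s => v 0 i) v0; rewrite !mxE.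
Qed.

End FreeBasis.

Section GroupRingQuotient.
Variables (Q : zmodType) (I : prime_idealr (grpring Q)).

Local Notation A := (gr_quot I).

Let pi : {rmorphism grpring Q -> A} := \pi_({ideal_quot I})%qT.

Lemma gr_ofD (p q : Q) : gr_of (p + q) = gr_of p * gr_of q.
Proof. by rewrite [RHS]gr_mulUU mulr1. Qed.

Lemma gr_imageD (p q : Q) : gr_image I (p + q) = gr_image I p * gr_image I q.
Proof. by rewrite -[LHS]/(pi _) gr_ofD rmorphM. Qed.

Lemma gr_image0 : gr_image I 0 = 1.
Proof. exact: (rmorph1 pi). Qed.

Lemma gr_imageMn (q : Q) n : gr_image I (q *+ n) = gr_image I q ^+ n.
Proof.
by elim: n => [|n IH]; rewrite ?mulr0n ?gr_image0 // mulrS gr_imageD IH exprS.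
Qed.

Lemma gr_image_neq0 (q : Q) : gr_image I q != 0.
Proof.
apply/eqP => e; have := gr_image0; rewrite -(subrr q) gr_imageD e mul0r.
by move/eqP; rewrite eq_sym oner_eq0.
Qed.

(** The opposites [- x i] are listed because a subring need not contain the inverses of its
    elements. *)
Lemma gr_quot_generated s (x : 'I_s -> Q) : generates x ->
  generated_over (intr : int -> A)
    ([seq gr_image I (x i) | i : 'I_s] ++ [seq gr_image I (- x i) | i : 'I_s]).
Proof.
move=> gen S Scl _ Sls.
have [S1 SB SM] := Scl.
have S0 : 0 \in S by rewrite -(subrr 1); exact: SB.
have SD u v : u \in S -> v \in S -> u + v \in S.
  by move=> Su Sv; rewrite -[v]opprK; apply: (SB _ _ Su); rewrite -sub0r; exact: SB.
have Sx i : gr_image I (x i) \in S.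
  by apply: Sls; rewrite mem_cat fintype.image_f.
have Snx i : gr_image I (- x i) \in S.
  by apply: Sls; rewrite mem_cat orbC (fintype.image_f (fun i => gr_image I (- x i))).
have SMn u n : gr_image I u \in S -> gr_image I (u *+ n) \in S.
  move=> Su; rewrite gr_imageMn; elim: n => [|n IH]; first by rewrite expr0.
  by rewrite exprS; exact: SM.
have Simg q : gr_image I q \in S.
  have /asboolP[m ->] := gen q.
  elim/big_ind: _ => [|u v Su Sv|i _]; first by rewrite gr_image0.
    by rewrite gr_imageD; exact: SM.
  case: (m i) => n; first exact: SMn.
  by rewrite NegzE mulrNz -mulNrz; exact: SMn.
move=> a; rewrite -[a]reprK -[\pi_(_)%qT _]/(pi _) [repr a]monalgE rmorph_sum.
elim/big_ind: _ => // k _.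
have -> : << (repr a)@_k *g k >> = gr_of k *~ (repr a)@_k.
  by rewrite /gr_of -raddfMz /= intz.
rewrite rmorphMz /= -/(gr_image I k).
have SMn' u n : u \in S -> u *+ n \in S.
  by move=> Su; elim: n => [|n IH] //; rewrite mulrS; exact: SD.
case: (_@_k) => n; first exact: SMn'.
by rewrite NegzE mulrNz -sub0r; apply: (SB _ _ S0); exact: SMn'.
Qed.

(** The ring [ZH / (ZH ∩ I)] embeds in [A], so relations may be tested in [A]. *)
Lemma gen_class_eq0 s (y : 'I_s -> Q) i i' (G : {poly {poly int}}) :
  eval2 intr (gen_class I y i) (gen_class I y i') G = 0 <->
  eval2 intr (gr_image I (y i)) (gr_image I (y i')) G = 0.
Proof.
pose B := subgrpring (gensub y).
pose pi' : {rmorphism B -> gen_quot I y} := \pi_({ideal_quot (restr_ideal (gensub y) I)})%qT.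
pose v : {rmorphism B -> grpring Q} := val.
pose Z := eval2 intr (subgr_of (gensub_gen y i)) (subgr_of (gensub_gen y i')) G : B.
have e1 : pi' Z = eval2 intr (gen_class I y i) (gen_class I y i') G.
  by rewrite (eval2_morph (h := pi') (g' := intr)) // => c; rewrite rmorph_int.
have e2 : pi (v Z) = eval2 intr (gr_image I (y i)) (gr_image I (y i')) G.
  rewrite (eval2_morph (h := v) (g' := intr)) => [|c]; last by rewrite rmorph_int.
  by rewrite (eval2_morph (h := pi) (g' := intr)) // => c; rewrite rmorph_int.
rewrite -e1 -e2.
have q1 : pi' Z == 0 = (Z \in (restr_ideal (gensub y) I : pred _)).
  by rewrite -[Z in RHS]subr0 Quotient.idealrBE -(rmorph0 pi').
have q2 : pi (v Z) == 0 = (v Z \in (I : pred _)).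
  by rewrite -[v Z in RHS]subr0 Quotient.idealrBE -(rmorph0 pi).
by split=> /eqP; rewrite ?q1 ?q2 => h; apply/eqP; rewrite ?q1 ?q2.
Qed.

End GroupRingQuotient.

Lemma alg_over_rat (D : idomainType) (a : D) :
  alg_over (intr : int -> {fraction D}) (FracField.tofrac a) -> algebraic_over_rat a.
Proof.
move=> [p p0 pa].
have e : map_poly (ratr : rat -> {fraction D}) (map_poly intr p) = map_poly intr p.
  apply/polyP => i; rewrite coef_poly; case: ltnP => [_|le].
    by rewrite !coef_map /= ratr_int.
  have : (p`_i)%:~R = 0 :> rat by rewrite -coef_map nth_default.
  by move/eqP; rewrite intr_eq0 coef_map => /eqP ->.
exists (map_poly intr p); last by rewrite e.
apply: contraNneq p0 => z; rewrite -e z.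
by apply/eqP/polyP => i; rewrite coef_poly size_poly0 coef0.
Qed.

Theorem theorem5p1 (s : nat) (Q : zmodType) (I : prime_idealr (grpring Q))
  (hs : (2 <= s)%N)
  (hQ : free_abelian_of_rank Q s)
  (hchar : [pchar (gr_quot I)] =i pred0)
  (hdim : krull_dim_eq (gr_quot I) 2)
  (halg : forall q : Q, q != 0 -> ~ algebraic_over_rat (gr_image I q)) :
  homothety_rigid I s.
Proof.
move=> x n c gen n0 c0 f hf i.
(* Since [s >= 2], a second basis element is available for relations in two variables. *)
have [i' ii'] : exists i' : 'I_s, i' != i.
  have [i0 | i_neq0] := eqVneq (val i) 0%N.
    by exists (Ordinal hs); rewrite -val_eqE /= i0.
  by exists (Ordinal (ltnW hs)); rewrite -val_eqE /= eq_sym.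
have ind := generates_independent hQ gen.
have ind2 (a b : int) : x i *~ a + x i' *~ b = 0 -> a = 0 /\ b = 0.
  pose m l := if l == i then a else if l == i' then b else 0.
  have -> : x i *~ a + x i' *~ b = \sum_(l < s) x l *~ m l.
    rewrite (bigD1 i) //= (bigD1 i') //= big1 ?addr0 => [|l /andP[li li']].
      by rewrite /m eqxx (negPf ii') eqxx.
    by rewrite /m (negPf li) (negPf li').
  by move=> /ind h; have := h i; have := h i'; rewrite /m eqxx (negPf ii') eqxx.
have transc q : q != 0 ->
    ~ alg_over (intr : int -> {fraction gr_quot I}) (FracField.tofrac (gr_image I q)).
  by move=> /halg nalg /alg_over_rat.
apply: (@homothetic_exponent (gr_quot I) hchar _ {fraction gr_quot I}
  (@FracField.tofrac (gr_quot I)) _ (gr_image I (x i)) (gr_image I (x i'))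
  _ _ n (c i) (c i')) => //.
- move=> a b; exact: krull_dim_dependent hchar (gr_quot_generated gen) hdim.
- by move=> a b /eqP; rewrite tofrac_eq => /eqP.
- apply: transc; apply/eqP => e.
  by have [|] := ind2 1 0; rewrite ?mulr0z ?addr0 ?mulr1z.
- move=> d m l d0.
  (* The monomial is the image of [q], which is nonzero because [x i] and [x i'] are independent and
     [d > 0]. *)
  pose q := x i' *+ d + x i *+ l - x i *+ m.
  have -> : FracField.tofrac (gr_image I (x i')) ^+ d *
       FracField.tofrac (gr_image I (x i)) ^+ l
     / FracField.tofrac (gr_image I (x i)) ^+ m = FracField.tofrac (gr_image I q).
    apply: (canLR (mulfK _)); first by rewrite expf_neq0 // tofrac_eq0 gr_image_neq0.
    by rewrite -!tofracXn -!tofracM -!gr_imageMn -!gr_imageD subrK.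
  apply: transc; apply/eqP => e.
  have [_ d00] : (l%:Z - m%:Z = 0) /\ d%:Z = 0.
    by apply: ind2; rewrite -[RHS]e mulrzBr addrC addrA.
  by case: d00 d0 => ->.
(* A relation in [A] is lifted to the source of [f], pushed through [f], and read again in [A]. *)
move=> G; rewrite -!gr_imageMn => /(gen_class_eq0 I (fun l => x l *+ n)) e.
apply/(gen_class_eq0 I (fun l => x l *+ c l)).
have := congr1 f e; rewrite (eval2_morph (h := f) (g' := intr)) => [|t].
  by rewrite !hf rmorph0.
by rewrite rmorph_int.
Qed.
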